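(* Let $W$ be a finite Coxeter group of type $A_n$, $B_n$ or $D_n$, realized combinatorially as below, and $c$ a Coxeter element. An element $w\in W$ is $c$-sortable if and only if the associated (signed) permutation satisfies, with respect to the barring corresponding to $c$, condition (A) in type $A_n$, condition (B) in type $B_n$, and condition (D) in type $D_n$.
   Context: $c$-sortable: for a reduced word $a_1\cdots a_n$ of the Coxeter element $c$ (an element with a reduced word that is a permutation of the simple generators $S$), form $c^\infty=a_1\cdots a_n|a_1\cdots a_n|\cdots$; the $c$-sorting word of $w$ is the lexicographically first (in positions of $c^\infty$) subword of $c^\infty$ that is a reduced word for $w$; $w$ is $c$-sortable if the sequence of sets of letters between consecutive dividers is weakly decreasing under inclusion. For noncommuting simple generators $s,t$, ''$s$ precedes $t$ in $c$'' means $s$ precedes $t$ in every reduced word for $c$. A ''subsequence'' means a (not necessarily consecutive) subsequence of the one-line notation (long one-line notation in types B, D). Type $A_n$: $W=S_{n+1}$, one-line notation $\pi_1\cdots\pi_{n+1}$, $s_i=(i\ i{+}1)$, $i\in[n]$. Barring of $[2,n]$: $i$ is upper-barred if $s_i$ precedes $s_{i-1}$ in $c$, lower-barred if $s_{i-1}$ precedes $s_i$. Condition (A): (A1) no subsequence $j\,k\,i$ with $i<j<k$ and $j$ upper-barred; (A2) no subsequence $k\,i\,j$ with $i<j<k$ and $j$ lower-barred. Type $B_n$: signed permutations $\pi$ of $\pm[n]$ ($\pi(-i)=-\pi(i)$), long one-line notation $\pi_{-n}\cdots\pi_{-1}\pi_1\cdots\pi_n$; $s_0=(-1\ 1)$,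 $s_i=(-i{-}1\ \ {-i})(i\ \ i{+}1)$ for $i\in[n-1]$. Barring of $[n-1]$: $i$ upper-barred if $s_i$ precedes $s_{i-1}$ in $c$, lower-barred if $s_{i-1}$ precedes $s_i$; extended to $\pm[n-1]$ by giving $-i$ the barring opposite to that of $i$. Condition (B): the long one-line notation has no subsequence $j\,k\,i$ with $i<j<k$ and $j$ upper-barred. Type $D_n$: even-signed permutations (signed permutations with an even number of $i\in[n]$ having $\pi_i<0$), long one-line notation as in type B; $s_i=(i\ i{+}1)(-i{-}1\ {-i})$ for $i\in[n-1]$, $s_0=(-2\ 1)(-1\ 2)$. $c$ is symmetric if it is invariant under the diagram automorphism swapping $s_0,s_1$, asymmetric otherwise. For $i\in[3,n-1]$: $i$ upper-barred if $s_i$ precedes $s_{i-1}$ in $c$, lower-barred otherwise. If $c$ is symmetric, $2$ is lower-barred if $s_0$ and $s_1$ precede $s_2$, upper-barred if $s_2$ precedes $s_0$ and $s_1$, and the central elements are $\pm1$. If $c$ is asymmetric, $1$ is lower-barred if $s_0$ precedes $s_2$ and $s_2$ precedes $s_1$, upper-barred if $s_2$ precedes $s_0$ and $s_1$ precedes $s_2$, and the central elements are $\pm 2$. Barrings are extended to negatives by giving $-i$ the barring opposite to $i$; $n$ and $-n$ count as both upper- and lower-barred; central elements are neither. Condition (D): (D1) no subsequence $j\,k\,i$ with $i<j<k$, $|i|,|j|,|k|$ distinct, $j$ upper-barred; (D2) no subsequence $j\,k\,i$ with $i<j<k$, $|i|,|j|,|k|$ distinct, $j$ central, $k$ and $i$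 lower-barred; (D3) no subsequence $j\,k\,i$ with $-k<i<j<k$, $|i|,|j|,|k|$ distinct, $j$ central, $k$ upper-barred and $i$ lower-barred; (D4) no subsequence $j\,k\,i$ with $i<j<k<-i$, $|i|,|j|,|k|$ distinct, $j$ central, $k$ lower-barred and $i$ upper-barred. *)

(* Defs.v *)
From mathcomp Require Import all_boot all_order all_algebra all_fingroup.

Set Implicit Arguments.
Unset Strict Implicit.
Unset Printing Implicit Defensive.

Import Order.TTheory GRing.Theory Num.Theory.
Local Open Scope ring_scope.

(** * Words, Coxeter elements and c-sortable elements

    [S] is the set of simple generators of a group of permutations of [X];
    a word is a sequence of elements of [S]. *)

(* a_1 ... a_k denotes a_1 \o ... \o a_k, i.e. (u v)(x) = u (v x), whereas the
   product of [{perm X}] satisfies (u * v) x = v (u x); hence the swap. *)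
Definition word_prod (X : finType) (a : seq {perm X}) : {perm X} :=
  foldr (fun u v => (v * u)%g) 1%g a.

Definition reduced_word (X : finType) (S : {set {perm X}}) (w : {perm X})
    (a : seq {perm X}) : Prop :=
  [/\ all (mem S) a, word_prod a = w
    & forall b : seq {perm X},
        all (mem S) b -> word_prod b = w -> (size a <= size b)%N].

Definition coxeter_element (X : finType) (S : {set {perm X}}) (c : {perm X}) :
    Prop :=
  exists2 a : seq {perm X}, reduced_word S c a & perm_eq a (enum S).

Definition precedes (X : finType) (S : {set {perm X}}) (c s t : {perm X}) :
    Prop :=
  forall a : seq {perm X}, reduced_word S c a -> subseq [:: s; t] a.

(* The letter of a^oo = a|a|a|... at position [p], counted from 0; position
   [p] lies in the block number [p %/ size a]. *)
Definition cinf (X : finType) (a : seq {perm X}) (p : nat) : {perm X} :=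
  nth 1%g a (p %% size a)%N.

Definition subword_for (X : finType) (S : {set {perm X}}) (a : seq {perm X})
    (w : {perm X}) (P : seq nat) : Prop :=
  sorted ltn P /\ reduced_word S w [seq cinf a p | p <- P].

(* The sorting word of [w] is represented by its sequence of positions in
   a^oo. *)
Definition sorting_word (X : finType) (S : {set {perm X}}) (a : seq {perm X})
    (w : {perm X}) (P : seq nat) : Prop :=
  subword_for S a w P /\
  forall Q : seq nat, subword_for S a w Q -> (P <= Q :> seqlexi nat)%O.

Definition block (X : finType) (a : seq {perm X}) (P : seq nat) (m : nat) :
    {set {perm X}} :=
  [set:: [seq cinf a p | p <- P & (p %/ size a)%N == m]].

(* [a] is a reduced word of the Coxeter element c. *)
Definition c_sortable (X : finType) (S : {set {perm X}}) (a : seq {perm X})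
    (w : {perm X}) : Prop :=
  exists2 P : seq nat, sorting_word S a w P
    & forall m : nat, block a P m.+1 \subset block a P m.

(** * Permutations of a finite set of integers

    [L] lists the integers that are permuted, in increasing order. *)

(* Evaluation of a permutation at an integer (extended by the identity). *)
Definition ev (L : seq int) (w : {perm seq_sub L}) (x : int) : int :=
  if (insub x : option (seq_sub L)) is Some u then val (w u) else x.

(* The transposition (x y), or the identity unless x and y are both in [L]. *)
Definition transp (L : seq int) (x y : int) : {perm seq_sub L} :=
  match insub x, insub y with
  | Some u, Some v => tperm u v
  | _, _ => 1%g
  end.

Definition one_line (L : seq int) (w : {perm seq_sub L}) : seq int :=
  [seq ev w x | x <- L].

Definition zrange (n : nat) : seq int := [seq i%:Z | i <- iota 1 n].

Definition pm_range (n : nat) : seq int :=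
  [seq - i | i <- rev (zrange n)] ++ zrange n.

(** * Type A *)

Notation permA n := {perm seq_sub (zrange n.+1)}.

Definition sA (n : nat) (i : int) : permA n := transp (zrange n.+1) i (i + 1).

Definition SA (n : nat) : {set permA n} := [set:: [seq sA n i | i <- zrange n]].

Definition upperA (n : nat) (c : permA n) (i : int) : Prop :=
  2 <= i <= n%:Z /\ precedes (SA n) c (sA n i) (sA n (i - 1)).

Definition lowerA (n : nat) (c : permA n) (i : int) : Prop :=
  2 <= i <= n%:Z /\ precedes (SA n) c (sA n (i - 1)) (sA n i).

Definition condA (n : nat) (c w : permA n) : Prop :=
  (forall i j k : int, i < j < k -> upperA c j ->
     ~ subseq [:: j; k; i] (one_line w)) /\
  (forall i j k : int, i < j < k -> lowerA c j ->
     ~ subseq [:: k; i; j] (one_line w)).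

(** * Type B *)

Notation permPM n := {perm seq_sub (pm_range n)}.

Definition signed (n : nat) (w : permPM n) : bool :=
  all (fun x => ev w (- x) == - ev w x) (pm_range n).

Definition WB (n : nat) : {set permPM n} := [set w : permPM n | signed w].

Definition sB (n : nat) (i : int) : permPM n :=
  if i == 0 then transp (pm_range n) (- 1) 1
  else (transp (pm_range n) (- i - 1) (- i) *
        transp (pm_range n) i (i + 1))%g.

Definition SB (n : nat) : {set permPM n} :=
  [set:: [seq sB n i%:Z | i <- iota 0 n]].

Definition posupperB (n : nat) (c : permPM n) (i : int) : Prop :=
  1 <= i < n%:Z /\ precedes (SB n) c (sB n i) (sB n (i - 1)).

Definition poslowerB (n : nat) (c : permPM n) (i : int) : Prop :=
  1 <= i < n%:Z /\ precedes (SB n) c (sB n (i - 1)) (sB n i).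

Definition upperB (n : nat) (c : permPM n) (i : int) : Prop :=
  posupperB c i \/ poslowerB c (- i).

Definition condB (n : nat) (c w : permPM n) : Prop :=
  forall i j k : int, i < j < k -> upperB c j ->
    ~ subseq [:: j; k; i] (one_line w).

(** * Type D *)

Definition WD (n : nat) : {set permPM n} :=
  [set w : permPM n |
    signed w && ~~ odd (count (fun i => ev w i < 0) (zrange n))].

Definition sD (n : nat) (i : int) : permPM n :=
  if i == 0 then (transp (pm_range n) (- 2) 1 *
                  transp (pm_range n) (- 1) 2)%g
  else (transp (pm_range n) i (i + 1) *
        transp (pm_range n) (- i - 1) (- i))%g.

Definition SD (n : nat) : {set permPM n} :=
  [set:: [seq sD n i%:Z | i <- iota 0 n]].

Definition symmetricD (n : nat) (c : permPM n) : Prop :=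
  exists2 f : {perm permPM n}, f \in Aut (WD n)
    & [/\ f (sD n 0) = sD n 1, f (sD n 1) = sD n 0,
          forall i : int, 2 <= i < n%:Z -> f (sD n i) = sD n i
        & f c = c].

(* Barring of the positive integers less than n. *)
Definition posupperD (n : nat) (c : permPM n) (i : int) : Prop :=
  [\/ 3 <= i < n%:Z /\ precedes (SD n) c (sD n i) (sD n (i - 1)),
      [/\ symmetricD c, i = 2, precedes (SD n) c (sD n 2) (sD n 0)
        & precedes (SD n) c (sD n 2) (sD n 1)]
    | [/\ ~ symmetricD c, i = 1, precedes (SD n) c (sD n 2) (sD n 0)
        & precedes (SD n) c (sD n 1) (sD n 2)]].

Definition poslowerD (n : nat) (c : permPM n) (i : int) : Prop :=
  [\/ 3 <= i < n%:Z /\ ~ precedes (SD n) c (sD n i) (sD n (i - 1)),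
      [/\ symmetricD c, i = 2, precedes (SD n) c (sD n 0) (sD n 2)
        & precedes (SD n) c (sD n 1) (sD n 2)]
    | [/\ ~ symmetricD c, i = 1, precedes (SD n) c (sD n 0) (sD n 2)
        & precedes (SD n) c (sD n 2) (sD n 1)]].

Definition upperD (n : nat) (c : permPM n) (i : int) : Prop :=
  [\/ posupperD c i, poslowerD c (- i) | `|i| = n%:Z].

Definition lowerD (n : nat) (c : permPM n) (i : int) : Prop :=
  [\/ poslowerD c i, posupperD c (- i) | `|i| = n%:Z].

Definition centralD (n : nat) (c : permPM n) (i : int) : Prop :=
  (symmetricD c /\ `|i| = 1) \/ (~ symmetricD c /\ `|i| = 2).

Definition D1 (n : nat) (c w : permPM n) : Prop :=
  forall i j k : int, i < j < k -> uniq [:: `|i|; `|j|; `|k|] ->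
    upperD c j -> ~ subseq [:: j; k; i] (one_line w).

Definition D2 (n : nat) (c w : permPM n) : Prop :=
  forall i j k : int, i < j < k -> uniq [:: `|i|; `|j|; `|k|] ->
    centralD c j -> lowerD c k -> lowerD c i ->
    ~ subseq [:: j; k; i] (one_line w).

Definition D3 (n : nat) (c w : permPM n) : Prop :=
  forall i j k : int, - k < i -> i < j < k -> uniq [:: `|i|; `|j|; `|k|] ->
    centralD c j -> upperD c k -> lowerD c i ->
    ~ subseq [:: j; k; i] (one_line w).

Definition D4 (n : nat) (c w : permPM n) : Prop :=
  forall i j k : int, i < j < k -> k < - i -> uniq [:: `|i|; `|j|; `|k|] ->
    centralD c j -> lowerD c k -> upperD c i ->
    ~ subseq [:: j; k; i] (one_line w).

Definition condD (n : nat) (c w : permPM n) : Prop :=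
  [/\ D1 c w, D2 c w, D3 c w & D4 c w].

(* Main.v *)
(** Types A, B and D are treated at once.  A group element [w] permutes a finite
    set [L] of integers; a root e_y - e_x is a pair (x, y) and it is an inversion
    of [w] when x < y and y occurs before x in the one-line notation.

    If the word [a = m :: b] of [c] is rotated to [rcons b m], sortability obeys
    a recursion: when [m] is a descent of [w], [w] is sortable for [a] iff
    [s_m w] is sortable for the rotated word; otherwise [w] is sortable for [a] iff
    [w] lies in the parabolic subgroup omitting [m] and is sortable for the
    rotated word.  Indeed the blocks of the sorting word decrease iff its set P of
    positions satisfies "p + n in P implies p in P", and this condition does not see
    where the dividers are.

    Let omega_c be the skew-symmetric form with omega_c(alpha_s, alpha_t) =
    - B(alpha_s, alpha_t) if s precedes t in [c].  Say that [w] is aligned if, for all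
    positive roots beta, gamma with beta + gamma a root and omega_c(beta, gamma) > 0,
    the inversion set does not contain gamma and beta + gamma without beta.
    Alignment obeys the same recursion, because rotation transports omega_c by the
    simple reflection s_m, and because omega_c(alpha_m, -) >= 0 forces an aligned [w]
    of which [m] is not a descent into the parabolic subgroup omitting [m].  Hence
    sortable and aligned agree.  For beta = e_j - e_i and gamma = e_k - e_j the sign
    of omega_c(beta, gamma) is given by the barring of j (and, in type D with j
    central, by that of i or k), so that alignment is pattern avoidance. *)

Require Import Defs.
From mathcomp Require Import all_boot all_order all_algebra all_fingroup.
From mathcomp Require Import zify.

Set Implicit Arguments.
Unset Strict Implicit.
Unset Printing Implicit Defensive.

Import Order.TTheory GRing.Theory Num.Theory.
Local Open Scope ring_scope.

(** * Evaluation and positions *)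

Section Evaluation.

Variable L : seq int.
Implicit Types (u v w : {perm seq_sub L}) (x y : int).

Lemma ev_sub w (x : seq_sub L) : ev w (val x) = val (w x).
Proof. by rewrite /ev valK. Qed.

Lemma ev_out w x : x \notin L -> ev w x = x.
Proof. by move=> xL; rewrite /ev insubF //; apply/negbTE. Qed.

Lemma ev_mem w x : (ev w x \in L) = (x \in L).
Proof.
have [xL|xL] := boolP (x \in L); last by rewrite ev_out // (negbTE xL).
by rewrite -[x]/(val (SeqSub xL)) ev_sub (valP (w (SeqSub xL))).
Qed.

Lemma ev1 x : ev (1%g : {perm seq_sub L}) x = x.
Proof.
have [xL|xL] := boolP (x \in L); last exact: ev_out.
by rewrite -[x in LHS]/(val (SeqSub xL)) ev_sub perm1.
Qed.

Lemma evM u v x : ev (u * v)%g x = ev v (ev u x).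
Proof.
have [xL|xL] := boolP (x \in L); last by rewrite !ev_out.
by rewrite -[x]/(val (SeqSub xL)) !ev_sub permM.
Qed.

Lemma evK w : cancel (ev w) (ev w^-1%g).
Proof. by move=> x; rewrite -evM mulgV ev1. Qed.

Lemma evVK w : cancel (ev w^-1%g) (ev w).
Proof. by move=> x; rewrite -evM mulVg ev1. Qed.

Lemma ev_inj w : injective (ev w). Proof. exact: can_inj (evK w). Qed.

Lemma ev_ext u v : {in L, ev u =1 ev v} -> u = v.
Proof.
by move=> e; apply/permP => x; apply: val_inj; rewrite -!ev_sub e ?(valP x).
Qed.

Lemma ev_extV u v : {in L, ev u^-1%g =1 ev v^-1%g} -> u = v.
Proof. by move=> e; apply: invg_inj; apply: ev_ext. Qed.

(** The place of the value [x] in the one-line notation, named by an element of [L]: [y] occurs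
    before [x] when [pos w y < pos w x]. *)
Definition pos w x := ev w^-1%g x.

Lemma pos_mem w x : (pos w x \in L) = (x \in L). Proof. exact: ev_mem. Qed.

Lemma pos_inj w : injective (pos w). Proof. exact: ev_inj. Qed.

Lemma pos1 x : pos 1%g x = x. Proof. by rewrite /pos invg1 ev1. Qed.

Lemma posM u v x : pos (u * v)%g x = pos u (pos v x).
Proof. by rewrite /pos invMg evM. Qed.

(** Applying [pos w] turns the one-line notation back into the increasing list [L], so its
    subsequences are the lists with increasing positions. *)
Lemma subseq_one_line w : sorted <%R L -> forall x y z,
  reflect ([/\ x \in L, y \in L & z \in L] /\ pos w x < pos w y < pos w z)
          (subseq [:: x; y; z] (one_line w)).
Proof.
move=> sL x y z; apply: (iffP idP) => [h|[[xL yL zL] h]].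
  have hL : {subset [:: x; y; z] <= L}.
    by move=> t /(mem_subseq h) /mapP [p pL ->]; rewrite ev_mem.
  split; first by rewrite !hL // !inE eqxx ?orbT.
  have := map_subseq (pos w) h; rewrite /one_line -map_comp.
  have E : pos w \o ev w =1 id by move=> p; rewrite /= /pos evK.
  rewrite (eq_map E) map_id => h'.
  have := subseq_sorted (@lt_trans _ _) h' sL.
  by rewrite /= andbT.
have -> : [:: x; y; z] = [seq ev w p | p <- [:: pos w x; pos w y; pos w z]].
  by rewrite /= /pos !evVK.
apply: map_subseq.
rewrite (_ : [:: _; _; _] = [seq p <- L | p \in [:: pos w x; pos w y; pos w z]]).
  exact: filter_subseq.
apply: (irr_sorted_eq (@lt_trans _ _) (@ltxx _ _)).
- by rewrite /= andbT.
- exact: (sorted_filter (@lt_trans _ _)).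
- move=> t; rewrite mem_filter; case: (boolP (t \in [:: _; _; _])) => //=.
  by rewrite !inE => /or3P [] /eqP ->; rewrite pos_mem.
Qed.

End Evaluation.

(** * Inversions and reduced words *)

(* [rootp x y] says that e_y - e_x is a root ([y <> - x] in type D); in types B
   and D, (x, y) and (- y, - x) denote the same root.  [simples m] lists the pairs
   denoting the simple root of [gen m], and [wt] weighs the pairs so that every
   simple root has the same total weight [wtot].  [kap m] is the fundamental
   coweight of [m] up to scaling: [kap m y - kap m x] is proportional to the
   coefficient of alpha_m in e_y - e_x. *)
Record realization (L : seq int) := Realization {
  idx : seq int;
  gen : int -> {perm seq_sub L};
  grp : pred {perm seq_sub L};
  rootp : rel int;
  simples : int -> seq (int * int);
  wt : int -> int -> nat;
  wtot : nat;
  kap : int -> int -> int;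
  L_uniq : uniq L;
  idx_uniq : uniq idx;
  grp1 : grp 1%g;
  grpM : forall m w, m \in idx -> grp w -> grp (w * gen m)%g;
  genK : forall m, m \in idx -> involutive (ev (gen m));
  root_sym : symmetric rootp;
  root_gen : forall m, m \in idx ->
    {in L &, forall x y, rootp (ev (gen m) x) (ev (gen m) y) = rootp x y};
  simple_uniq : forall m, m \in idx -> uniq (simples m);
  simple_mem : forall m x y, m \in idx -> (x, y) \in simples m ->
    (x \in L) && (y \in L);
  simpleE : forall m, m \in idx -> {in L &, forall x y, ((x, y) \in simples m) =
    [&& rootp x y, x < y & ev (gen m) y < ev (gen m) x]};
  simple_swap : forall m x y, m \in idx -> (x, y) \in simples m ->
    ev (gen m) x = y;
  wt_gen : forall m, m \in idx ->
    {in L &, forall x y, wt (ev (gen m) x) (ev (gen m) y) = wt x y};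
  wtot_gt0 : (0 < wtot)%N;
  simple_wt : forall m, m \in idx ->
    (\sum_(p <- simples m) wt p.1 p.2 = wtot)%N;
  desc_dich : forall m w p q, m \in idx -> grp w -> p \in simples m ->
    q \in simples m -> pos w p.2 < pos w p.1 -> pos w q.2 < pos w q.1;
  no_desc : forall w, grp w ->
    (forall m p, m \in idx -> p \in simples m -> pos w p.1 < pos w p.2) ->
    w = 1%g;
  kap_gen : forall m r, m \in idx -> r \in idx -> m != r ->
    {in L, forall x, kap m (ev (gen r) x) = kap m x};
  kap_simple : forall m x y, m \in idx -> (x, y) \in simples m ->
    kap m x < kap m y
}.

Section Words.

Variables (L : seq int) (D : realization L).
Implicit Types (w : {perm seq_sub L}) (m r : int) (e : seq int).

Notation idx := (idx D).
Notation gen := (gen D).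
Notation grp := (grp D).
Notation rootp := (rootp D).
Notation simples := (simples D).
Notation wt := (wt D).
Notation K := (wtot D).
Notation kap := (kap D).
Notation act m := (ev (gen m)).

Definition gens : {set {perm seq_sub L}} := [set:: [seq gen m | m <- idx]].

Definition wprod e : {perm seq_sub L} := word_prod [seq gen m | m <- e].

(** As products of [{perm}] are reversed, [(w * gen m)%g] is s_m w and [desc] means left descent.
    For [w] in the group all pairs denoting alpha_m agree by [desc_dich], so testing for one of them
    is enough. *)
Definition desc m w := has (fun p => pos w p.2 < pos w p.1) (simples m).

(** On group elements this is [wtot D] times the Coxeter length. *)
Definition ninv w : nat :=
  (\sum_(p <- [seq (x, y) | x <- L, y <- L]
     | [&& rootp p.1 p.2, (p.1 < p.2)%R & (pos w p.2 < pos w p.1)%R]) wt p.1 p.2)%N.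

Lemma prod_cons m e : wprod (m :: e) = (wprod e * gen m)%g.
Proof. by []. Qed.

Lemma gen_sq m : m \in idx -> (gen m * gen m)%g = 1%g.
Proof. by move=> mI; apply: ev_ext => x _; rewrite evM genK // ev1. Qed.

Lemma gen_inv m : m \in idx -> ((gen m)^-1 = gen m)%g.
Proof. by move=> mI; apply/eqP; rewrite eq_invg_mul gen_sq. Qed.

Lemma mulgenK m w : m \in idx -> (w * gen m * gen m = w)%g.
Proof. by move=> mI; rewrite -mulgA gen_sq // mulg1. Qed.

Lemma pos_gen m w x : m \in idx -> pos (w * gen m)%g x = pos w (act m x).
Proof. by move=> mI; rewrite posM {2}/pos gen_inv. Qed.

Lemma simple_swap2 m x y : m \in idx -> (x, y) \in simples m -> act m y = x.
Proof. by move=> mI xy; rewrite -(simple_swap mI xy) genK. Qed.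

Lemma simple_lt m x y : m \in idx -> (x, y) \in simples m -> x < y.
Proof.
move=> mI xy; have /andP [xL yL] := simple_mem mI xy.
by move: xy; rewrite simpleE // => /and3P [].
Qed.

Lemma simple_n0 m : m \in idx -> exists x y, (x, y) \in simples m.
Proof.
move=> mI; case E: (simples m) => [|[x y] s]; last first.
  by exists x, y; rewrite inE eqxx.
by have := simple_wt mI; have := wtot_gt0 D; rewrite E big_nil => + h; rewrite -h.
Qed.

Lemma desc_all m w : m \in idx -> grp w ->
  desc m w -> forall x y, (x, y) \in simples m -> pos w y < pos w x.
Proof. by move=> mI gw /hasP [p ps h] x y xy; apply: (desc_dich mI gw ps xy h). Qed.

Lemma ascP m w : m \in idx -> ~~ desc m w ->
  forall x y, (x, y) \in simples m -> pos w x < pos w y.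
Proof.
move=> mI /hasPn h x y xy; have := h _ xy; rewrite -leNgt le_eqVlt /=.
by case/orP=> // /eqP /pos_inj e; have := simple_lt mI xy; rewrite e ltxx.
Qed.

Lemma desc_gen m w : m \in idx -> grp w -> desc m (w * gen m)%g = ~~ desc m w.
Proof.
move=> mI gw; have [x [y xy]] := simple_n0 mI.
have [dw|dw] := boolP (desc m w); last first.
  apply/hasP; exists (x, y) => //=; rewrite !pos_gen //.
  by rewrite (simple_swap mI xy) (simple_swap2 mI xy) (ascP mI dw xy).
apply/hasPn => -[x' y'] xy' /=; rewrite !pos_gen // -leNgt.
by rewrite (simple_swap mI xy') (simple_swap2 mI xy') ltW // (desc_all mI gw dw).
Qed.

Lemma pairsE (p : int * int) :
  (p \in [seq (x, y) | x <- L, y <- L]) = (p.1 \in L) && (p.2 \in L).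
Proof.
case: p => x y; apply/allpairsP/idP => [[[a b] [/= aL bL [-> ->]]]|/andP [xL yL]].
  by rewrite aL bL.
by exists (x, y).
Qed.

Lemma sum_simple m (Q : pred (int * int)) (F : int * int -> nat) : m \in idx ->
  (\sum_(p <- [seq (x, y) | x <- L, y <- L] | (p \in simples m) && Q p) F p
   = \sum_(p <- simples m | Q p) F p)%N.
Proof.
move=> mI; rewrite big_mkcondr -big_filter [RHS]big_mkcond.
apply: perm_big; apply: uniq_perm.
- by rewrite filter_uniq // allpairs_uniq ?L_uniq // => -[? ?] [? ?].
- exact: simple_uniq.
move=> p; rewrite mem_filter pairsE; case: p => x y.
by case xy: (_ \in simples m) => //=; have := simple_mem mI xy.
Qed.

(** s_m permutes the positive roots other than alpha_m, so it matches the other inversions of [w]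
    with the inversions of s_m w; alpha_m is an inversion of [w] only. [A] is the common part. *)
Lemma ninv_desc m w : m \in idx -> grp w -> desc m w ->
  ninv w = (ninv (w * gen m)%g + K)%N.
Proof.
move=> mI gw dw; set LL := [seq (x, y) | x <- L, y <- L].
pose A := (\sum_(p <- LL | [&& rootp p.1 p.2, (p.1 < p.2)%R,
            (act m p.1 < act m p.2)%R & (pos w p.2 < pos w p.1)%R]) wt p.1 p.2)%N.
have actlt x y : x != y -> (act m y < act m x) = ~~ (act m x < act m y).
  by move=> xy; case: ltgtP => // e; rewrite (ev_inj e) eqxx in xy.
have -> : ninv w = (A + K)%N.
  rewrite /ninv (bigID (fun p : int * int => act m p.1 < act m p.2)) /=.
  congr addn; first by apply: eq_bigl => p; rewrite -!andbA; do !bool_congr.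
  (* The pairs whose order s_m reverses are the simple pairs, and all of them are inverted. *)
  rewrite -(simple_wt mI) -(sum_simple xpredT (fun p => wt p.1 p.2)) //.
  rewrite big_seq_cond [RHS]big_seq_cond.
  apply: eq_bigl => -[x y]; rewrite pairsE /=; case xL: (_ \in _) => //=.
  case yL: (_ \in _) => //=; rewrite andbT simpleE //.
  case rxy: (rootp x y) => //=; case xy: (x < y) => //=.
  have ne : x != y by rewrite lt_eqF.
  rewrite (actlt x y ne) andbC; case E: (~~ _) => //=.
  have s : (x, y) \in simples m by rewrite simpleE // rxy xy (actlt x y ne) E.
  by rewrite (desc_all mI gw dw s).
congr addn.
have -> : ninv (w * gen m)%g = (\sum_(p <- LL | [&& rootp p.1 p.2,
     (act m p.1 < act m p.2)%R & (pos w p.2 < pos w p.1)%R]) wt p.1 p.2)%N.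
  have pLL : perm_eq LL [seq (act m p.1, act m p.2) | p <- LL].
    apply: uniq_perm; first by rewrite allpairs_uniq ?L_uniq // => -[? ?] [? ?].
      rewrite map_inj_in_uniq ?allpairs_uniq ?L_uniq // => [[? ?] [? ?]|] //.
      by move=> [? ?] [? ?] _ _ [/ev_inj -> /ev_inj ->].
    move=> [x y]; rewrite pairsE /=; apply/idP/mapP => [/andP [xL yL]|].
      exists (act m x, act m y); rewrite ?pairsE ?ev_mem ?xL //=.
      by rewrite !genK.
    by case=> -[a b]; rewrite pairsE => /= h [-> ->]; rewrite !ev_mem.
  rewrite /ninv (perm_big _ pLL) big_map big_seq_cond [RHS]big_seq_cond.
  apply: eq_big => [[x y]|[x y]]; rewrite pairsE /=.
    case xL: (_ \in _) => //=; case yL: (_ \in _) => //=.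
    by rewrite root_gen // !pos_gen // !genK.
  by case/andP=> /andP [xL yL] _; rewrite wt_gen.
(* After reindexing by s_m, a pair with p.1 >= p.2 would be a reversed simple pair, which the
   descent forbids. *)
rewrite (bigID (fun p : int * int => p.1 < p.2)) /= [X in (_ + X)%N]big1_seq ?addn0.
  by apply: eq_bigl => p; do !bool_congr; rewrite andbC !andbA.
case=> x y; rewrite pairsE /= => /andP [/andP [/and3P [rxy a p] xy] /andP [xL yL]].
have ne : x != y by apply: contraTneq a => ->; rewrite ltxx.
have s : (y, x) \in simples m.
  by rewrite simpleE // root_sym rxy a lt_neqAle eq_sym ne leNgt xy.
by have := desc_all mI gw dw s; rewrite ltNge ltW.
Qed.

Lemma ninv_asc m w : m \in idx -> grp w -> ~~ desc m w ->
  ninv (w * gen m)%g = (ninv w + K)%N.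
Proof.
move=> mI gw aw; rewrite (ninv_desc mI) ?mulgenK //; first exact: grpM.
by rewrite desc_gen.
Qed.

Lemma ninv1 : ninv 1%g = 0%N.
Proof. by rewrite /ninv big1 // => p /and3P [_]; rewrite !pos1 => /ltW; case: ltgtP. Qed.

Lemma pos_asc_eq1 w : grp w -> {in idx, forall m, ~~ desc m w} -> w = 1%g.
Proof.
by move=> gw h; apply: (no_desc gw) => m [x y] mI; apply: ascP => //; apply: h.
Qed.

Lemma grp_prod e : {subset e <= idx} -> grp (wprod e).
Proof.
elim: e => [|m e IH] h; first exact: grp1.
rewrite prod_cons; apply: grpM; first by rewrite h // inE eqxx.
by apply: IH => r re; rewrite h // inE re orbT.
Qed.

Lemma ninv_prod e : {subset e <= idx} -> (ninv (wprod e) <= K * size e)%N.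
Proof.
elim: e => [|m e IH] h; first by rewrite ninv1.
have he : {subset e <= idx} by move=> r re; rewrite h // inE re orbT.
have mI : m \in idx by rewrite h // inE eqxx.
rewrite prod_cons /= mulnS; have [d|d] := boolP (desc m (wprod e)).
  by have := ninv_desc mI (grp_prod he) d; have := IH he; lia.
by rewrite (ninv_asc mI (grp_prod he) d) addnC leq_add2l IH.
Qed.

(** Descents are stripped one at a time, each lowering [ninv] by [wtot D], until [no_desc] leaves
    the identity. *)
Lemma exists_word w : grp w ->
  exists2 e, {subset e <= idx} & wprod e = w /\ (K * size e)%N = ninv w.
Proof.
move: {2}(ninv w).+1 (ltnSn (ninv w)) => d; elim: d w => // d IH w hd gw.
have [/hasP [m mI dm]|/hasPn h] := boolP (has (desc^~ w) idx); last first.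
  exists [::] => //; rewrite (pos_asc_eq1 gw); last by move=> m mI; exact: h.
  by rewrite ninv1 muln0.
have E := ninv_desc mI gw dm; have K0 := wtot_gt0 D.
have [|e he [pe se]] := IH (w * gen m)%g _ (grpM mI gw); first by lia.
exists (m :: e) => [r|]; first by rewrite inE => /orP [/eqP ->|/he].
by rewrite prod_cons /= mulnS pe mulgenK // se addnC -E.
Qed.
End Words.

(** * Sorting words and rotation *)

Section Positions.

Variable X : finType.
Implicit Types (S : {set {perm X}}) (w s : {perm X}) (a b : seq {perm X}).

Lemma cinf_rot s b p : cinf (rcons b s) p = cinf (s :: b) p.+1.
Proof.
rewrite /cinf size_rcons /= nth_rcons.
have hq : (p %% (size b).+1 < (size b).+1)%N by rewrite ltn_mod.
rewrite -(addn1 p) -modnDml addn1; move: hq.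
set q := (p %% _)%N; rewrite ltnS leq_eqVlt => /orP [/eqP ->|hq].
  by rewrite ltnn eqxx modnn.
by rewrite hq modn_small.
Qed.

Lemma cinf_period a p : cinf a (p + size a) = cinf a p.
Proof. by rewrite /cinf modnDr. Qed.

Lemma map_cinf_rot s b Q :
  [seq cinf (rcons b s) p | p <- Q] = [seq cinf (s :: b) p | p <- map S Q].
Proof. by rewrite -map_comp; apply: eq_map => p; rewrite cinf_rot. Qed.

Lemma sorted_succ Q : sorted ltn (map S Q) = sorted ltn Q.
Proof. by rewrite sorted_map; apply: eq_sorted => x y /=. Qed.

Lemma subword_rot S s b w Q :
  subword_for S (rcons b s) w Q <-> subword_for S (s :: b) w (map succn Q).
Proof. by rewrite /subword_for map_cinf_rot sorted_succ. Qed.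

Lemma lexi_succ (P Q : seq nat) :
  (map S P <= map S Q :> seqlexi nat)%O = (P <= Q :> seqlexi nat)%O.
Proof.
elim: P Q => [|p P IH] [|q Q] //=; rewrite !lexi_cons IH; congr (_ && _).
Qed.

Lemma sorted_pred Q : sorted ltn Q -> 0%N \notin Q -> exists Q', Q = map S Q'.
Proof.
move=> _ h; exists (map predn Q); rewrite -map_comp -[LHS]map_id.
by apply/eq_in_map => -[|q] //= q0; rewrite q0 in h.
Qed.

Lemma sorted_cons_notin x Q : sorted ltn (x :: Q) -> forall y, (y <= x)%N -> y \notin Q.
Proof.
move=> /= h y yx; apply/negP => /(allP (order_path_min ltn_trans h)).
by rewrite ltnNge yx.
Qed.

(** Closure under one step back by [N]: a form of the decrease of blocks that does not mention the
    dividers. *)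
Definition periodic (N : nat) (P : seq nat) :=
  forall p, (p + N)%N \in P -> p \in P.

(** As the letters of [a] are distinct, a letter lying in two successive blocks sits at positions
    that differ by exactly [size a]. *)
Lemma blocks_decreasing a P : uniq a -> (0 < size a)%N ->
  (forall m, block a P m.+1 \subset block a P m) <-> periodic (size a) P.
Proof.
move=> ua a0; split=> h.
  move=> p pP; have : cinf a (p + size a) \in block a P (p %/ size a).
    apply: (subsetP (h _)); rewrite inE; apply: map_f; rewrite mem_filter pP andbT.
    by rewrite divnDr // divnn a0 addn1.
  rewrite inE => /mapP [q]; rewrite mem_filter => /andP [/eqP qp qP].
  rewrite cinf_period /cinf => /eqP; rewrite nth_uniq ?ltn_mod // => /eqP e.
  by rewrite (divn_eq p (size a)) e -qp -divn_eq.
move=> m; apply/subsetP => x; rewrite !inE => /mapP [p].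
rewrite mem_filter => /andP [/eqP pm pP] ->.
have pa : (size a <= p)%N.
  by rewrite leqNgt; apply/negP => /divn_small; rewrite pm.
have pE : (p - size a + size a)%N = p by rewrite subnK.
rewrite -pE cinf_period; apply: map_f; rewrite mem_filter h ?pE // andbT.
by move: pm; rewrite -{1}pE divnDr // divnn a0 addn1 => -[->].
Qed.

(** Each letter is taken from the block whose number is the current lower bound, which puts it at or
    beyond that bound. This supplies competitors for lexicographic minimality. *)
Lemma embed_word a e k : {subset e <= a} -> exists Q,
  [/\ sorted ltn Q, all (leq k) Q & [seq cinf a p | p <- Q] = e].
Proof.
elim: e k => [|r e IH] k h; first by exists [::].
have ra : r \in a by rewrite h // inE eqxx.
have a0 : (0 < size a)%N by case: (a) ra.
have [|Q [sQ kQ EQ]] := IH (index r a + k * size a).+1.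
  by move=> t te; rewrite h // inE te orbT.
exists ((index r a + k * size a)%N :: Q); split => /=.
- by rewrite path_sortedE ?kQ //; exact: ltn_trans.
- apply/andP; split; first by nia.
  by apply/allP => t /(allP kQ); nia.
by rewrite EQ /cinf addnC modnMDl modn_small ?index_mem // nth_index.
Qed.

End Positions.

(** * Reduced words and parabolic subgroups *)

Section Sorting.

Variables (L : seq int) (D : realization L).
Implicit Types (w : {perm seq_sub L}) (m r : int) (e : seq int).

Notation idx := (idx D).
Notation gen := (gen D).
Notation grp := (grp D).
Notation rootp := (rootp D).
Notation simples := (simples D).
Notation K := (wtot D).
Notation kap := (kap D).
Notation act m := (ev (gen m)).
Notation gens := (gens D).
Notation wprod := (wprod D).
Notation ninv := (ninv D).
Notation desc := (desc D).

Lemma gensP s : reflect (exists2 m, m \in idx & s = gen m) (s \in gens).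
Proof. by rewrite inE; apply: mapP. Qed.

Lemma gens_word a : all (mem gens) a -> exists2 e, {subset e <= idx} & a = map gen e.
Proof.
elim: a => [|s a IH] /=; first by exists [::].
case/andP => /gensP [m mI ->] /IH [e he ->].
by exists (m :: e) => // r; rewrite inE => /orP [/eqP ->|/he].
Qed.

Definition red w e := [/\ {subset e <= idx}, wprod e = w & (K * size e)%N = ninv w].

(** [ninv_prod] bounds the length of every word of [w] from below, and [exists_word] attains the
    bound. *)
Lemma reducedP w e : {subset e <= idx} -> reduced_word gens w (map gen e) <-> red w e.
Proof.
move=> he; have K0 := wtot_gt0 D; split=> [[_ pe mine]|[_ pe se]].
  have gw : grp w by rewrite -pe; exact: grp_prod.
  split=> //; apply/eqP; rewrite eqn_leq -{2}pe ninv_prod // andbT.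
  have [f hf [pf <-]] := exists_word gw.
  have := mine (map gen f); rewrite !size_map leq_pmul2l //; apply=> //.
  by apply/allP => s /mapP [m /hf mI ->]; apply/gensP; exists m.
split=> // [|b /gens_word [f hf ->] pf].
  by apply/allP => s /mapP [m /he mI ->]; apply/gensP; exists m.
by rewrite !size_map -(leq_pmul2l K0) se -pf; exact: ninv_prod.
Qed.

(** If [m] is not a descent, s_m w has a larger [ninv] than [w], more than the remaining letters [e]
    can account for. *)
Lemma red_cons w m e : m \in idx -> red w (m :: e) <-> desc m w /\ red (w * gen m)%g e.
Proof.
move=> mI; have K0 := wtot_gt0 D.
have cE : {subset m :: e <= idx} <-> {subset e <= idx}.
  split=> h r re; first by rewrite h // inE re orbT.
  by move: re; rewrite inE => /orP [/eqP ->|/h].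
split=> [[/cE he pe se]|[dw [he pe se]]].
  have gw : grp w by rewrite -pe; apply: grp_prod; apply/cE.
  have pe' : wprod e = (w * gen m)%g by rewrite -pe prod_cons mulgenK.
  have dw : desc m w.
    apply: contraTT isT => aw; have := ninv_asc mI gw aw.
    have := ninv_prod he; rewrite pe'; move: se => /=; rewrite mulnS => <-.
    by move=> h1 h2; move: h1; rewrite h2 addnAC -addnA; lia.
  split=> //; split=> //; apply/eqP; rewrite -(eqn_add2r K).
  by rewrite -(ninv_desc mI gw dw) -se /= mulnS addnC.
have pw : wprod (m :: e) = w by rewrite prod_cons pe mulgenK.
have gw : grp w by rewrite -pw; apply: grp_prod; apply/cE.
by split; rewrite ?cE // (ninv_desc mI gw dw) -se /= mulnS addnC.
Qed.

Lemma red_grp w e : red w e -> grp w.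
Proof. by case=> he <- _; exact: grp_prod. Qed.

Lemma red_exists w : grp w -> exists e, red w e.
Proof. by move=> /exists_word [e he [pe se]]; exists e. Qed.

(* No inversion has alpha_m in its support: [w] lies in the parabolic subgroup
   that omits [m]. *)
Definition nocross m w := {in L &, forall x y,
  x < y -> rootp x y -> pos w y < pos w x -> kap m x = kap m y}.

(** For r distinct from m the letter r preserves [kap m] and, off its simple pairs, matches the
    inversions of [w] with those of s_r w. For r = m, alpha_m itself is an inversion across which
    [kap m] grows. *)
Lemma nocross_gen m r w : m \in idx -> r \in idx -> grp w -> desc r w ->
  nocross m w <-> m != r /\ nocross m (w * gen r)%g.
Proof.
move=> mI rI gw dw; split=> [nc|[mr nc] x y xL yL xy rxy inv].
  have mr : m != r.
    apply/eqP => mr; have [x [y xy]] := simple_n0 rI.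
    have /andP [xL yL] := simple_mem rI xy.
    have rxy : rootp x y by move: (xy); rewrite simpleE // => /and3P [].
    have := nc x y xL yL (simple_lt rI xy) rxy (desc_all rI gw dw xy).
    by move: (xy); rewrite -mr => /(kap_simple mI) h e; rewrite e ltxx in h.
  split=> // x y xL yL xy rxy; rewrite !pos_gen // => inv.
  have [a|a] := ltP (act r x) (act r y).
    rewrite -(kap_gen mI rI mr xL) -(kap_gen mI rI mr yL).
    by apply: nc; rewrite ?ev_mem // root_gen.
  have s : (x, y) \in simples r.
    rewrite simpleE // rxy xy lt_neqAle a andbT.
    by apply: contraTneq xy => /ev_inj ->; rewrite ltxx.
  move: inv; rewrite (simple_swap rI s) (simple_swap2 rI s) => inv.
  by have := desc_all rI gw dw s; rewrite ltNge ltW.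
have [a|a] := ltP (act r x) (act r y).
  rewrite -(kap_gen mI rI mr xL) -(kap_gen mI rI mr yL).
  by apply: nc; rewrite ?ev_mem // ?root_gen // !pos_gen // !genK.
have s : (x, y) \in simples r.
  rewrite simpleE // rxy xy lt_neqAle a andbT.
  by apply: contraTneq xy => /ev_inj ->; rewrite ltxx.
by rewrite -(simple_swap rI s) kap_gen.
Qed.

(** Applied to two reduced words of one element, this shows that they use the same letters. *)
Lemma nocross_word m w e : m \in idx -> red w e -> nocross m w <-> m \notin e.
Proof.
move=> mI; elim: e w => [|r e IH] w rw.
  case: rw => _ <- _; split=> // _ x y _ _ xy _; rewrite !pos1 => yx.
  by have := lt_trans xy yx; rewrite ltxx.
have rI : r \in idx by case: rw => h _ _; rewrite h // inE eqxx.
have [dw rw'] := (red_cons w e rI).1 rw.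
have := nocross_gen mI rI (red_grp rw) dw; have := IH _ rw'.
rewrite inE negb_or => -[i1 i2] [h1 h2].
by split=> [/h1 [-> /i1]|/andP [mr /i2 h]]; last exact: h2.
Qed.

(** [kap m] is fixed by every other letter but changed by [gen m] on a simple pair of [m]. *)
Lemma gen_inj : {in idx &, injective gen}.
Proof.
move=> m r mI rI e; apply/eqP; apply: contraTT isT => mr.
have [x [y xy]] := simple_n0 mI; have /andP [xL _] := simple_mem mI xy.
have := kap_simple mI xy; rewrite -(simple_swap mI xy) e (kap_gen mI rI mr xL).
by rewrite ltxx.
Qed.

(** * Sortability under rotation of the word of c *)

Section Rotation.

Variables (m : int) (b : seq int).
Hypothesis mb : perm_eq (m :: b) idx.

Let mI : m \in idx. Proof. by rewrite -(perm_mem mb) inE eqxx. Qed.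
Let umb : uniq (m :: b). Proof. by rewrite (perm_uniq mb) idx_uniq. Qed.
Let a := map gen (m :: b).
Let a' := map gen (rcons b m).

Let hb r : r \in m :: b -> r \in idx. Proof. by rewrite (perm_mem mb). Qed.

Let ua : uniq a.
Proof. by rewrite map_inj_in_uniq // => x y /hb xI /hb yI; exact: gen_inj. Qed.

Let aE : a' = rcons (map gen b) (gen m). Proof. exact: map_rcons. Qed.

Let ua' : uniq a'.
Proof. by rewrite aE rcons_uniq -cons_uniq. Qed.

Let szE : size a' = size a. Proof. by rewrite aE size_rcons. Qed.

Let subE w Q : subword_for gens a' w Q <-> subword_for gens a w (map S Q).
Proof. by rewrite aE subword_rot. Qed.

Let word_of P : exists2 e, {subset e <= m :: b} & [seq cinf a p | p <- P] = map gen e.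
Proof.
exists [seq nth 0 (m :: b) (p %% size a) | p <- P] => [r /mapP [p _ ->]|].
  by rewrite mem_nth // -(size_map gen) ltn_mod.
rewrite -map_comp; apply: eq_map => p /=; rewrite /cinf.
by rewrite (nth_map 0) // -(size_map gen) ltn_mod.
Qed.

(** Position 0 carries the letter [m]. Dropping it from a subword for [w] leaves a subword for s_m
    w, read in the rotated word after shifting positions by one. *)
Let sub0 w P : desc m w ->
  subword_for gens a w (0%N :: map S P) <-> subword_for gens a' (w * gen m)%g P.
Proof.
move=> dw; rewrite subE /subword_for.
have [e /[dup] he0 he Ee] := word_of (map S P).
have {}he : {subset e <= idx} by move=> r /he /hb.
rewrite (_ : [seq cinf a p | p <- 0%N :: _] = map gen (m :: e)); last first.
  by rewrite /= -/a Ee.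
rewrite Ee !reducedP //; last by move=> r; rewrite inE => /orP [/eqP ->|/he].
rewrite red_cons // (_ : sorted ltn (0%N :: map S P) = sorted ltn (map S P)).
  by split=> [[h [_ h']]|[h h']].
rewrite /= path_sortedE; last exact: ltn_trans.
by rewrite (_ : all _ _ = true) //; apply/allP => p /mapP [q _ ->].
Qed.

(** Some subword for [w] uses position 0, so the lexicographically first one does too; removing that
    position gives the sorting word of s_m w for the rotated word. *)
Lemma sortable_desc w : grp w -> desc m w ->
  c_sortable gens a w <-> c_sortable gens a' (w * gen m)%g.
Proof.
move=> gw dw; have a0 : (0 < size a)%N by [].
have a'0 : (0 < size a')%N by rewrite szE.
split=> -[P [sP minP] /blocks_decreasing clP].
  have [f rf] := red_exists (grpM mI gw).
  have fI : {subset f <= idx} by case: rf.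
  (* The bound 1 keeps position 0 free, so that [m] can be put in front of the word of s_m w. *)
  have [|Q [sQ kQ EQ]] := @embed_word _ a (map gen f) 1.
    by move=> s /mapP [r rf' ->]; apply: map_f; rewrite (perm_mem mb) fI.
  have [Q' EQ'] : exists Q', Q = map S Q'.
    by apply: sorted_pred => //; apply/negP => /(allP kQ).
  have : (P <= 0%N :: map S Q' :> seqlexi nat)%O.
    apply: minP; apply/sub0 => //; apply/subE; rewrite -EQ'; split=> //.
    by rewrite EQ; apply/reducedP.
  case: P sP minP clP => [|p P] sP minP clP.
    case: sP => _ [_ /= w1 _] _; have [x [y xy]] := simple_n0 mI.
    have := desc_all mI gw dw xy; rewrite -w1 !pos1 ltNge ltW //.
    exact: (simple_lt mI xy).
  rewrite lexi_cons leEnat leqn0 => /andP [/eqP p0 _]; subst p.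
  have [P' EP'] : exists P', P = map S P'.
    case: sP => sP _; apply: sorted_pred; first exact: path_sorted sP.
    exact: sorted_cons_notin sP _ _.
  subst P; exists P'; first split; first by apply/sub0.
    move=> Q1 /(sub0 _ dw) /minP; rewrite lexi_cons lexx /=.
    by rewrite lexi_succ.
  apply/blocks_decreasing => // p; rewrite szE => pP.
  have := clP ua a0 p.+1; rewrite !inE addSn !(mem_map succn_inj) /=; exact.
exists (0%N :: map S P); first split; first by apply/sub0.
  move=> [|[|q] Q] sQ.
  - case: sQ => _ [_ /= w1 _]; have [x [y xy]] := simple_n0 mI.
    have := desc_all mI gw dw xy; rewrite -w1 !pos1 ltNge ltW //.
    exact: (simple_lt mI xy).
  - rewrite lexi_cons lexx /=.
    have [Q' EQ'] : exists Q', Q = map S Q'.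
      case: sQ => sQ _; apply: sorted_pred; first exact: path_sorted sQ.
      exact: sorted_cons_notin sQ _ _.
    by move: sQ; rewrite EQ' lexi_succ => /(sub0 _ dw) /minP.
  - by rewrite lexi_cons.
(* Position 0 is in the list, so closure at 0 is automatic; the other instances are shifted by
   one. *)
apply/blocks_decreasing => // -[|p]; rewrite !inE //= addSn /=.
rewrite !(mem_map succn_inj) => pP.
by apply: clP => //; rewrite szE.
Qed.

Lemma sortable_asc w : grp w -> ~~ desc m w ->
  c_sortable gens a w <-> nocross m w /\ c_sortable gens a' w.
Proof.
move=> gw dw; have a0 : (0 < size a)%N by [].
have a'0 : (0 < size a')%N by rewrite szE.
have mpos p : (p %% size a)%N = 0%N -> cinf a p = gen m.
  by rewrite /cinf => ->.
have posm p : cinf a p = gen m -> (p %% size a)%N = 0%N.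
  rewrite /cinf (_ : gen m = nth 1%g a 0) // => /eqP.
  by rewrite nth_uniq // ?ltn_mod // => /eqP.
(* The letter [m] occupies exactly the multiples of [size a]. *)
have use P : subword_for gens a w P ->
    nocross m w <-> ~~ has (fun p => p %% size a == 0)%N P.
  move=> [_]; have [e he Ee] := word_of P.
  rewrite Ee reducedP => [re|r /he /hb //].
  rewrite (nocross_word mI re); have -> : (m \in e) = (gen m \in map gen e).
    apply/idP/mapP => [|[r re' E]]; first by exists m.
    by rewrite (gen_inj mI (hb (he _ re')) E).
  rewrite -Ee; have -> // : (gen m \in [seq cinf a p | p <- P])
       = has (fun p => p %% size a == 0)%N P.
  apply/mapP/hasP => [[p pP E]|[p pP /eqP /mpos]]; last by exists p.
  by exists p => //; apply/eqP/posm.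
have no0 P : subword_for gens a w P -> 0%N \notin P.
  move=> [sP rP]; case: P sP rP => [|[|p] P] sP //; last first.
    by rewrite inE negb_or /= => _; exact: sorted_cons_notin sP _ _.
  have [e he Ee] := word_of P.
  rewrite (_ : [seq cinf a p | p <- 0%N :: _] = map gen (m :: e)); last first.
    by rewrite /= -/a Ee.
  rewrite reducedP => [|r]; last by rewrite inE => /orP [/eqP ->|/he /hb].
  by rewrite red_cons // (negbTE dw) => -[].
split=> [[P [sP minP] /blocks_decreasing clP]|[nc [P [sP minP] /blocks_decreasing clP]]].
  have n0 := no0 _ sP; have nk k : (k * size a)%N \notin P.
    elim: k => [|k IH]; first by rewrite mul0n.
    by apply: contra IH => h; apply: (clP ua a0); rewrite addnC -mulSn.
  split.
    apply/(use P sP)/hasPn => p pP; apply: contra (nk (p %/ size a)%N) => /eqP p0.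
    by rewrite (divn_eq p (size a)) p0 addn0 in pP.
  have [P' EP'] : exists P', P = map S P' by apply: sorted_pred => //; case: sP.
  subst P; exists P'; first split; first by apply/subE.
    by move=> Q /subE /minP; rewrite lexi_succ.
  apply/blocks_decreasing => // p; rewrite szE => pP.
  have := clP ua a0 p.+1; rewrite addSn !(mem_map succn_inj); exact.
exists (map S P); first split; first by apply/subE.
  move=> Q sQ; have [Q' EQ'] : exists Q', Q = map S Q'.
    by apply: sorted_pred; [case: sQ | exact: no0].
  by subst Q; rewrite lexi_succ; apply: minP; apply/subE.
apply/blocks_decreasing => // -[|p]; last first.
  by rewrite addSn !(mem_map succn_inj) => pP; apply: clP => //; rewrite szE.
rewrite add0n => h; have /subE sP' := sP.
by have /hasPn /(_ _ h) := (use _ sP').1 nc; rewrite modnn.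
Qed.

End Rotation.
End Sorting.

(** * Aligned elements *)

Definition triple L (D : realization L) (i j k : int) :=
  [/\ [/\ i \in L, j \in L & k \in L], i < j < k
    & [/\ rootp D i j, rootp D j k & rootp D i k]].

(** With beta = e_j - e_i and gamma = e_k - e_j, the pattern j k i has the inversions beta and beta
    + gamma without gamma, and k i j has gamma and beta + gamma without beta. The sign of [f] tells
    which of the two is forbidden. *)
Definition aligned L (D : realization L) (f : int -> int -> int -> int)
    (w : {perm seq_sub L}) :=
  forall i j k, triple D i j k ->
    (f i j k < 0 -> ~~ (pos w j < pos w k < pos w i)) /\
    (0 < f i j k -> ~~ (pos w k < pos w i < pos w j)).

(* [form e i j k] has the sign of omega_c(e_j - e_i, e_k - e_j), where [e] is the
   word of [c]. *)
Record orientation L (D : realization L) := Orientation {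
  form : seq int -> int -> int -> int -> int;
  form_gen : forall m b i j k, perm_eq (m :: b) (idx D) -> triple D i j k ->
    (i, j) \notin simples D m -> (j, k) \notin simples D m ->
    form (rcons b m) (ev (gen D m) i) (ev (gen D m) j) (ev (gen D m) k)
    = form (m :: b) i j k;
  form_lo : forall m b i j k, perm_eq (m :: b) (idx D) -> triple D i j k ->
    (i, j) \in simples D m ->
    (0 <= form (m :: b) i j k) && (form (rcons b m) i j k <= 0);
  form_hi : forall m b i j k, perm_eq (m :: b) (idx D) -> triple D i j k ->
    (j, k) \in simples D m ->
    (form (m :: b) i j k <= 0) && (0 <= form (rcons b m) i j k);
  form_kap : forall m b i j k, perm_eq (m :: b) (idx D) -> triple D i j k ->
    kap D m i = kap D m k -> form (rcons b m) i j k = form (m :: b) i j k;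
  aligned_nocross : forall m b w, perm_eq (m :: b) (idx D) -> grp D w ->
    aligned D (form (m :: b)) w -> ~~ desc D m w -> nocross D m w
}.

(** * The recursion for aligned elements *)

Section Alignment.

Variables (L : seq int) (D : realization L) (O : orientation D).
Implicit Types (w : {perm seq_sub L}) (m r : int) (e : seq int).

Notation idx := (idx D).
Notation gen := (gen D).
Notation grp := (grp D).
Notation rootp := (rootp D).
Notation simples := (simples D).
Notation kap := (kap D).
Notation act m := (ev (gen m)).
Notation gens := (gens D).
Notation wprod := (wprod D).
Notation ninv := (ninv D).
Notation desc := (desc D).
Notation nocross := (nocross D).
Notation triple := (triple D).
Notation aligned e w := (aligned D (form O e) w).

Lemma simple_act m x y : m \in idx -> x \in L -> y \in L -> x < y -> rootp x y ->
  (x, y) \notin simples m -> act m x < act m y.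
Proof.
move=> mI xL yL xy rxy; rewrite simpleE // rxy xy /= -leNgt le_eqVlt.
by case/orP=> // /eqP /ev_inj e; rewrite e ltxx in xy.
Qed.

Lemma triple_act m i j k : m \in idx -> triple i j k ->
  (i, j) \notin simples m -> (j, k) \notin simples m ->
  triple (act m i) (act m j) (act m k) /\ (act m i, act m j) \notin simples m /\
  (act m j, act m k) \notin simples m.
Proof.
move=> mI [[iL jL kL] /andP [ij jk] [rij rjk rik]] nij njk.
have aij := simple_act mI iL jL ij rij nij.
have ajk := simple_act mI jL kL jk rjk njk.
split; first by split; rewrite ?ev_mem ?aij ?ajk // !root_gen.
by rewrite !simpleE ?ev_mem // !genK // (lt_gtF ij) (lt_gtF jk) !andbF.
Qed.

(** Triples without a simple pair of [m] are carried by s_m to such triples with the same form. In a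
    triple containing alpha_m the sign bounds leave one pattern to exclude, and it contradicts the
    descent. *)
Lemma aligned_desc m b w : perm_eq (m :: b) idx -> grp w -> desc m w ->
  aligned (m :: b) w <-> aligned (rcons b m) (w * gen m)%g.
Proof.
move=> mb gw dw; have mI : m \in idx by rewrite -(perm_mem mb) inE eqxx.
split=> al i j k t.
  have [ij|nij] := boolP ((i, j) \in simples m).
    have /andP [_ h] := form_lo O mb t ij; split; last by rewrite ltNge h.
    move=> _; rewrite !pos_gen // (simple_swap mI ij) (simple_swap2 mI ij).
    apply/negP => /andP [h1 h2]; have := desc_all mI gw dw ij.
    by rewrite ltNge ltW // (lt_trans h1 h2).
  have [jk|njk] := boolP ((j, k) \in simples m).
    have /andP [_ h] := form_hi O mb t jk; split; first by rewrite ltNge h.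
    move=> _; rewrite !pos_gen // (simple_swap mI jk) (simple_swap2 mI jk).
    apply/negP => /andP [h1 h2]; have := desc_all mI gw dw jk.
    by rewrite ltNge ltW // (lt_trans h1 h2).
  have [t' [nij' njk']] := triple_act mI t nij njk.
  have := form_gen O mb t' nij' njk'; rewrite !genK // !pos_gen // => ->.
  exact: al.
have [ij|nij] := boolP ((i, j) \in simples m).
  have /andP [h _] := form_lo O mb t ij; split; first by rewrite ltNge h.
  move=> _; apply/negP => /andP [_ h2]; have := desc_all mI gw dw ij.
  by rewrite ltNge ltW.
have [jk|njk] := boolP ((j, k) \in simples m).
  have /andP [h _] := form_hi O mb t jk; split; last by rewrite ltNge h.
  move=> _; apply/negP => /andP [h1 h2]; have := desc_all mI gw dw jk.
  by rewrite ltNge ltW.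
have [t' _] := triple_act mI t nij njk.
by have := al _ _ _ t'; rewrite (form_gen O mb t nij njk) !pos_gen // !genK.
Qed.

(** Both patterns invert the pair (i, k), so [nocross] makes [kap m] agree at [i] and [k], and the
    two forms coincide there by [form_kap]. *)
Lemma aligned_asc m b w : perm_eq (m :: b) idx -> grp w -> ~~ desc m w ->
  aligned (m :: b) w <-> nocross m w /\ aligned (rcons b m) w.
Proof.
move=> mb gw dw.
suff h : nocross m w -> aligned (m :: b) w <-> aligned (rcons b m) w.
  split=> [al|[nc /(h nc)]//]; have nc := aligned_nocross mb gw al dw.
  by split=> //; exact: (h nc).1.
move=> nc; split=> al i j k /[dup] t [[iL jL kL] /andP [ij jk] [_ _ rik]];
  (have [ki|ki] := ltP (pos w k) (pos w i); last by split=> _; lia);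
  have e := nc i k iL kL (lt_trans ij jk) rik ki; have := al i j k t;
  by rewrite (form_kap O mb t e) ki.
Qed.

Lemma sortable1 e : perm_eq e idx -> c_sortable gens (map gen e) 1%g.
Proof.
move=> eI; exists [::] => [|m]; last by apply/subsetP => x; rewrite !inE.
by split=> //; split=> //; split=> //= b.
Qed.

Lemma aligned1 e : aligned e 1%g.
Proof. by move=> i j k [_ h _]; rewrite !pos1; split=> _; lia. Qed.

(** Induction on [ninv w]: a nontrivial [w] has a descent, the word is rotated until a descent m
    leads, and then [w] is replaced by s_m w. *)
Theorem sortable_aligned e w : perm_eq e idx -> grp w ->
  c_sortable gens (map gen e) w <-> aligned e w.
Proof.
move: {2}(ninv w).+1 (ltnSn (ninv w)) => d; elim: d e w => // d IH e w hd eI gw.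
have step m b : perm_eq (m :: b) idx -> desc m w ->
    c_sortable gens (map gen (m :: b)) w <-> aligned (m :: b) w.
  move=> mb dm; have mI : m \in idx by rewrite -(perm_mem mb) inE eqxx.
  apply: (iff_trans (sortable_desc mb gw dm)).
  apply: (iff_trans _ (iff_sym (aligned_desc mb gw dm))).
  apply: IH; last exact: grpM; last by rewrite perm_rcons.
  by have := ninv_desc mI gw dm; have := wtot_gt0 D; lia.
have [/hasP [m mI dm]|/hasPn h] := boolP (has (desc^~ w) idx); last first.
  rewrite (pos_asc_eq1 gw (h : {in _, _})).
  by split=> _; [exact: aligned1 | exact: sortable1].
have me : m \in e by rewrite (perm_mem eI).
(* The inner induction is on the prefix [p] in front of the descent [m]; each rotation past a letter
   that is not a descent shortens it. *)
case/splitPr: me eI => p q; elim: p q => [|r p IHp] q eI; first exact: step.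
have [dr|dr] := boolP (desc r w); first exact: step.
apply: (iff_trans (sortable_asc eI gw dr)).
apply: (iff_trans _ (iff_sym (aligned_asc eI gw dr))).
have := IHp (rcons q r).
rewrite -[p ++ _ :: rcons q r]/(p ++ rcons (m :: q) r) -rcons_cat.
rewrite perm_rcons => /(_ eI) [h1 h2].
by split=> -[nc] => [/h1|/h2].
Qed.

(** By [nocross_word] every reduced word of c uses every letter, and since reduced words have equal
    length it uses each once. *)
Lemma coxeter_word c a : coxeter_element gens c -> reduced_word gens c a ->
  exists2 e, perm_eq e idx & a = map gen e /\ c = wprod e.
Proof.
move=> [a0 r0 p0] ra.
have [f hf Ef] := gens_word (let: And3 h _ _ := r0 in h).
have [e he Ee] := gens_word (let: And3 h _ _ := ra in h); subst a a0.
have rf : red D c f by apply/reducedP.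
have re : red D c e by apply/reducedP.
have fI m : m \in idx -> m \in f.
  move=> mI; have : gen m \in map gen f.
    by rewrite (perm_mem p0) mem_enum; apply/gensP; exists m.
  by case/mapP => r /[dup] rf' /hf rI /(gen_inj mI rI) ->.
have Ie : {subset idx <= e}.
  move=> m mI; apply: contraTT (fI m mI) => /(nocross_word mI re).
  by move/(nocross_word mI rf).
have uf : uniq f.
  by apply: (@map_uniq _ _ gen); rewrite (perm_uniq p0) enum_uniq.
have sz : size e = size f.
  case: re rf => _ _ se [_ _ sf]; apply/eqP.
  by rewrite -(eqn_pmul2l (wtot_gt0 D)) se sf.
exists e; last by split=> //; case: re.
rewrite perm_sym; apply: uniq_perm => //; first exact: idx_uniq.
  apply: (leq_size_uniq (idx_uniq D) Ie); rewrite sz; exact: uniq_leq_size.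
move=> m; apply/idP/idP; [exact: Ie | exact: he].
Qed.

Definition before e i j := (index i e < index j e)%N.

Lemma subseq_before e i j : perm_eq e idx -> i \in idx -> j \in idx -> i != j ->
  subseq [:: gen i; gen j] (map gen e) = before e i j.
Proof.
move=> eI iI jI ij; have ue : uniq e by rewrite (perm_uniq eI) idx_uniq.
have he : {subset e <= idx} by move=> r; rewrite (perm_mem eI).
have ii : i \in e by rewrite (perm_mem eI).
have jj : j \in e by rewrite (perm_mem eI).
rewrite /before {eI}; elim: e ue he ii jj => //= r e IH /andP [re ue] he.
have rI : r \in idx by rewrite he // inE eqxx.
have geq t : t \in idx -> (gen t == gen r) = (t == r).
  by move=> tI; apply/eqP/eqP => [/(gen_inj tI rI)|->].
have {}IH := IH ue (fun t te => he t (mem_behead (s := r :: e) te)).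
rewrite !inE geq // [r == i]eq_sym [r == j]eq_sym.
case: (eqVneq i r) => [ir|ir] /=; last first.
  case: (eqVneq j r) => [jr|jr] /=; last by move=> ie je; rewrite IH.
  move=> _ _; rewrite ltn0; apply/negP => /mem_subseq /(_ (gen j)).
  rewrite !inE eqxx orbT => /(_ isT) /mapP [t te] /(gen_inj jI) tj.
  by move: re; rewrite -jr tj ?te // he // inE te orbT.
case: (eqVneq j r) => [jr|jr] /=; first by rewrite ir jr eqxx in ij.
by move=> _ je; rewrite sub1seq map_f.
Qed.

(** [precedes] speaks of all reduced words of c. The last hypothesis says that c alone determines
    the order of [i] and [j]; in each type this is checked by reading the order off [pos]. *)
Lemma precedesP e i j : perm_eq e idx -> reduced_word gens (wprod e) (map gen e) ->
  coxeter_element gens (wprod e) -> i \in idx -> j \in idx -> i != j ->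
  (forall f, perm_eq f idx -> wprod f = wprod e -> before e i j -> before f i j) ->
  precedes gens (wprod e) (gen i) (gen j) <-> before e i j.
Proof.
move=> eI re ce iI jI ij h; split=> [/(_ _ re)|b a ra].
  by rewrite subseq_before.
have [f fI [-> pf]] := coxeter_word ce ra.
by rewrite subseq_before //; exact: h.
Qed.

Lemma pos_prod_cons m e x : m \in idx -> pos (wprod (m :: e)) x = pos (wprod e) (act m x).
Proof. by move=> mI; rewrite prod_cons pos_gen. Qed.

Lemma pos_prod_cat e f x : {subset e <= idx} ->
  pos (wprod (e ++ f)) x = pos (wprod f) (pos (wprod e) x).
Proof.
elim: e x => [|m e IH] x h; first by rewrite pos1.
have mI : m \in idx by rewrite h // inE eqxx.
by rewrite /= !pos_prod_cons // IH // => r re; rewrite h // inE re orbT.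
Qed.

Lemma kap_prod m e x : m \in idx -> {subset e <= idx} -> m \notin e -> x \in L ->
  kap m (pos (wprod e) x) = kap m x.
Proof.
move=> mI; elim: e x => [|r e IH] x h me xL; first by rewrite pos1.
have rI : r \in idx by rewrite h // inE eqxx.
move: me; rewrite inE negb_or => /andP [mr me].
rewrite pos_prod_cons // IH ?ev_mem // ?kap_gen // => t te.
by rewrite h // inE te orbT.
Qed.

Lemma pos_prod_fix e x : {subset e <= idx} -> {in e, forall m, act m x = x} ->
  pos (wprod e) x = x.
Proof.
elim: e => [|m e IH] h fx; first by rewrite pos1.
have mI : m \in idx by rewrite h // inE eqxx.
rewrite pos_prod_cons // fx ?inE ?eqxx // IH // => r re.
  by rewrite h // inE re orbT.
by rewrite fx // inE re orbT.
Qed.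

End Alignment.

(** * Tools common to the three types *)

Ltac split_ifs := try lia;
  repeat (match goal with |- context [if ?b then _ else _] =>
            lazymatch b with context [if _ then _ else _] => fail | _ => idtac end;
            case: (boolP b) => ?
          end; try lia).

Lemma mem_zrange n x : (x \in zrange n) = (1 <= x <= n%:Z).
Proof.
apply/mapP/idP => [[i] |h]; first by rewrite mem_iota => h ->; lia.
by exists `|x|%N; rewrite ?mem_iota; lia.
Qed.

Lemma zrange_uniq n : uniq (zrange n).
Proof. by rewrite map_inj_uniq ?iota_uniq // => x y [->]. Qed.

Lemma zrange_sorted n : sorted <%R (zrange n).
Proof.
rewrite /zrange sorted_map; have := iota_ltn_sorted 1 n.
by apply: sub_sorted => x y /=; lia.
Qed.

Lemma ev_transp L x y z : x \in L -> y \in L ->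
  ev (transp L x y) z = if z == x then y else if z == y then x else z.
Proof.
move=> xL yL; rewrite /transp !insubT.
have [zL|zL] := boolP (z \in L); last first.
  rewrite ev_out //; case: eqP => [e|_]; first by rewrite e xL in zL.
  by case: eqP => [e|_] //; rewrite e yL in zL.
rewrite -[z]/(val (SeqSub zL)) ev_sub /=.
case: tpermP => [/(congr1 val) /= ->|/(congr1 val) /= ->|/eqP h1 /eqP h2] /=.
- by rewrite eqxx.
- by rewrite eqxx; case: eqP => // ->.
- by move: h1 h2; rewrite -!val_eqE /= => /negbTE -> /negbTE ->.
Qed.

Section Before.

Variables (m : int) (b : seq int).
Hypothesis umb : uniq (m :: b).

Lemma before_head j : j != m -> before (m :: b) m j.
Proof. by move=> jm; rewrite /before /= eqxx eq_sym (negbTE jm). Qed.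

Lemma before_headF i : before (m :: b) i m = false.
Proof. by rewrite /before /= eqxx ltn0. Qed.

Let mb : m \notin b. Proof. by case/andP: umb. Qed.

Let index_last : index m (rcons b m) = size b.
Proof. by rewrite -cats1 index_cat (negbTE mb) /= eqxx addn0. Qed.

Let index_in i : i \in b -> index i (rcons b m) = index i b.
Proof. by move=> ib; rewrite -cats1 index_cat ib. Qed.

Lemma before_last i : i \in b -> before (rcons b m) i m.
Proof. by move=> ib; rewrite /before index_last index_in // index_mem. Qed.

Lemma before_lastF j : j \in b -> before (rcons b m) m j = false.
Proof.
by move=> jb; rewrite /before index_last index_in //; apply/negbTE; rewrite -leqNgt index_size.
Qed.

Lemma before_rot i j : i \in b -> j \in b ->
  before (rcons b m) i j = before (m :: b) i j.
Proof.
move=> ib jb; rewrite /before !index_in //=.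
case: eqP => [e|_]; first by have := mb; rewrite e ib.
by case: eqP => [e|_]; first by have := mb; rewrite e jb.
Qed.

End Before.

(** The sign of omega_c(alpha_i, alpha_j) for noncommuting letters [i] and [j]. *)
Definition bar e i j : int := if before e i j then 1 else -1.

(** A strictly increasing integer function that starts on or above the diagonal stays there, and one
    that ends on or below it was so all along. *)
Lemma mono_id (lo hi : int) (g : int -> int) : lo <= g lo -> g hi <= hi ->
  (forall x, lo <= x < hi -> g x < g (x + 1)) -> forall x, lo <= x <= hi -> g x = x.
Proof.
move=> glo ghi mono x xlh.
have up (k : nat) : lo + k%:Z <= hi -> lo + k%:Z <= g (lo + k%:Z).
  elim: k => [|k IH] h; first by rewrite addr0.
  have -> : lo + k.+1%:Z = lo + k%:Z + 1 by lia.
  have := mono (lo + k%:Z); have := IH; lia.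
have dn (k : nat) : lo <= hi - k%:Z -> g (hi - k%:Z) <= hi - k%:Z.
  elim: k => [|k IH] h; first by rewrite subr0.
  have := mono (hi - k.+1%:Z); have -> : hi - k.+1%:Z + 1 = hi - k%:Z by lia.
  have := IH; lia.
have := up `|x - lo|%N; have := dn `|hi - x|%N.
have -> : hi - `|hi - x|%N%:Z = x by lia.
have -> : lo + `|x - lo|%N%:Z = x by lia.
lia.
Qed.

(** No inversion straddles the noninverted pair (p, q): the sign at [q] keeps every y > q from
    standing before [p], and then the sign at [p] forbids the pattern p y x. This serves types A and
    B, where every pair is a root. *)
Lemma aligned_adjacent L (D : realization L) f w p q :
  aligned D f w -> (forall x y, rootp D x y) -> p \in L -> q \in L -> p < q ->
  (forall x y, triple D x p y -> f x p y < 0) ->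
  (forall x y, triple D x q y -> 0 < f x q y) ->
  pos w p < pos w q ->
  forall x y, x \in L -> y \in L -> x <= p -> q <= y -> pos w x <= pos w y.
Proof.
move=> al rt pL qL pq fp fq ppq x y xL yL xp qy; rewrite leNgt; apply/negP => yx.
have tr i j k : i \in L -> j \in L -> k \in L -> i < j < k -> triple D i j k.
  by move=> *; split; rewrite ?rt.
have qy_lt : q < y -> ~~ (pos w y < pos w p).
  move=> h; have t : triple D p q y by apply: tr; rewrite ?pq.
  by have [_ /(_ (fq _ _ t))] := al _ _ _ t; rewrite ppq andbT.
have := @pos_inj _ w y p.
case: (ltgtP x p) xp => // [xp _|xp _]; last first.
  subst x; have : q != y by apply/eqP => e; subst; lia.
  by lia.
have [e|ne] := eqVneq q y.
  subst y; have t : triple D x p q by apply: tr; rewrite ?xp.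
  by have [/(_ (fp _ _ t))] := al _ _ _ t; rewrite ppq yx.
have t : triple D x p y by apply: tr => //; lia.
have [/(_ (fp _ _ t))] := al _ _ _ t; rewrite yx andbT; lia.
Qed.

(** * Type A *)

Section TypeA.

Variable n : nat.
Notation L := (zrange n.+1).
Implicit Types (m x : int) (e : seq int).

Lemma ev_sA m x : m \in zrange n ->
  ev (sA n m) x = if x == m then m + 1 else if x == m + 1 then m else x.
Proof. by rewrite mem_zrange => h; rewrite /sA ev_transp // mem_zrange; lia. Qed.

Definition kapA m x : int := if m < x then 1 else 0.

Fact no_descA (w : permA n) :
  (forall m p, m \in zrange n -> p \in [:: (m, m + 1)] -> pos w p.1 < pos w p.2) ->
  w = 1%g.
Proof.
move=> h; apply: ev_extV => x; rewrite mem_zrange invg1 ev1 => hx.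
have inL (y : int) : (1 <= y <= n.+1%:Z) -> 1 <= pos w y <= n.+1%:Z.
  by rewrite -!mem_zrange pos_mem.
apply: (@mono_id 1 n.+1%:Z (pos w)) => //; first by case/andP: (inL 1 isT).
  by case/andP: (inL n.+1%:Z ltac:(lia)).
move=> y hy; apply: (h y (y, y + 1)); rewrite ?inE // mem_zrange; lia.
Qed.

Definition typeA : realization L.
Proof.
apply: (@Realization L (zrange n) (sA n) xpredT (fun _ _ => true)
  (fun m => [:: (m, m + 1)]) (fun _ _ => 1%N) 1 kapA) => //.
- exact: zrange_uniq.
- exact: zrange_uniq.
- by move=> m mI x; rewrite !ev_sA //; split_ifs.
- by move=> m x y; rewrite inE !mem_zrange => ? /eqP [-> ->]; lia.
- by move=> m mI x y xL yL; rewrite inE -pair_eqE /= !ev_sA //; split_ifs.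
- by move=> m x y mI; rewrite inE => /eqP [-> ->]; rewrite ev_sA // eqxx.
- by move=> m mI; rewrite big_seq1.
- by move=> m w p q _ _; rewrite !inE => /eqP -> /eqP ->.
- by move=> w _; exact: no_descA.
- by move=> m r mI rI mr x _; rewrite ev_sA // /kapA; split_ifs.
- by move=> m x y mI; rewrite inE /kapA => /eqP [-> ->]; split_ifs.
Defined.

(** The only noncommuting letters, one in the support of e_j - e_i and one in that of e_k - e_j, are
    [j - 1] and [j]. The value is positive when [j] is lower-barred. *)
Definition formA e (i j k : int) : int := bar e (j - 1) j.

Lemma tripleA i j k : triple typeA i j k <-> [&& 1 <= i, i < j, j < k & k <= n.+1%:Z].
Proof.
rewrite /triple !mem_zrange; split=> [[[h1 h2 h3] h4 _]|h]; first lia.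
by split=> //; [split; lia | lia].
Qed.

End TypeA.

Lemma mem_tail (s : seq int) m b x : perm_eq (m :: b) s -> x \in s -> x != m -> x \in b.
Proof. by move=> mb; rewrite -(perm_mem mb) inE => /orP [->|]. Qed.

Lemma before_total e (i j : int) : i \in e -> i != j -> before e j i = ~~ before e i j.
Proof.
move=> ie ij; rewrite /before -leqNgt ltn_neqAle; case: eqP => // E.
by case/eqP: ij; rewrite -(nth_index 0 ie) -E nth_index // -index_mem E index_mem.
Qed.

(* Only the letters [p] and [q] move [x], and [kap p] is constant once [p] has been
   applied: this is how [c] remembers which of [p] and [q] comes first. *)
Lemma kap_pos_before L (D : realization L) e p q x :
  perm_eq e (idx D) -> p \in idx D -> x \in L ->
  {in idx D, forall r, r != p -> r != q -> ev (gen D r) x = x} ->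
  before e p q -> kap D p (pos (wprod D e) x) = kap D p (ev (gen D p) x).
Proof.
move=> eI pI xL fx; have pe : p \in e by rewrite (perm_mem eI).
have ue : uniq e by rewrite (perm_uniq eI) idx_uniq.
case/splitPr: pe eI ue => e1 e2 eI.
rewrite cat_uniq /= negb_or => /and4P [u1 /andP [p1 _] p2 u2].
have h1 : {subset e1 <= idx D} by move=> r r1; rewrite -(perm_mem eI) mem_cat r1.
have h2 : {subset e2 <= idx D}.
  by move=> r r2; rewrite -(perm_mem eI) mem_cat inE r2 !orbT.
rewrite /before !index_cat (negbTE p1) /= eqxx addn0.
case: ifP => [q1|q1 _]; first by rewrite ltnNge ltnW // index_mem.
rewrite pos_prod_cat // pos_prod_cons // (pos_prod_fix h1).
  by rewrite kap_prod // ev_mem.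
move=> r r1; apply: fx; first exact: h1.
  by apply: contraNneq p1 => <-.
by apply: contraFneq q1 => <-.
Qed.

(** * The orientation in type A *)

Section OrientationA.

Variable n : nat.

Definition orientA : orientation (typeA n).
Proof.
apply: (@Orientation _ (typeA n) formA).
- move=> m b i j k mb /tripleA t; rewrite !inE -!pair_eqE /= => nij njk.
  have u : uniq (m :: b) by rewrite (perm_uniq mb) zrange_uniq.
  have mI : m \in zrange n by rewrite -(perm_mem mb) inE eqxx.
  have tl (x : int) : 1 <= x <= n%:Z -> x != m -> x \in b.
    by rewrite -mem_zrange; exact: mem_tail.
  move: (mI); rewrite mem_zrange => mn.
  rewrite /formA /bar /= !ev_sA //.
  (* s_m exchanges m and m + 1, and moving [m] from the first place to the last reverses the barring
     of each, so the two changes cancel. *)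
  case: (eqVneq j m) => [jm|jm].
    by subst j; rewrite addrK before_lastF ?before_headF //; apply: tl; lia.
  case: (eqVneq j (m + 1)) => [jm1|jm1].
    by subst j; rewrite addrK before_last ?before_head //; first [lia | apply: tl; lia].
  by rewrite before_rot //; apply: tl; lia.
- move=> m b i j k mb /tripleA t; rewrite inE => /eqP [? ?]; subst i j.
  have u : uniq (m :: b) by rewrite (perm_uniq mb) zrange_uniq.
  have mI : m \in zrange n by rewrite -(perm_mem mb) inE eqxx.
  rewrite /formA /bar addrK before_head ?before_lastF //; last by lia.
  by apply: (mem_tail mb); rewrite /= ?mem_zrange; lia.
- move=> m b i j k mb /tripleA t; rewrite inE => /eqP [? ?]; subst j k.
  have u : uniq (m :: b) by rewrite (perm_uniq mb) zrange_uniq.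
  have mI : m \in zrange n by rewrite -(perm_mem mb) inE eqxx.
  rewrite /formA /bar before_headF before_last //.
  by apply: (mem_tail mb); rewrite /= ?mem_zrange; lia.
- move=> m b i j k mb /tripleA t; rewrite /= /kapA => h.
  have u : uniq (m :: b) by rewrite (perm_uniq mb) zrange_uniq.
  have nj : (j != m) && (j - 1 != m) by move: h; split_ifs.
  by rewrite /formA /bar before_rot //; apply: (mem_tail mb); rewrite /= ?mem_zrange; lia.
move=> m b w mb _ al dw x y xL yL xy _ inv.
have u : uniq (m :: b) by rewrite (perm_uniq mb) zrange_uniq.
have mI : m \in zrange n by rewrite -(perm_mem mb) inE eqxx.
have mn : 1 <= m <= n%:Z by rewrite -mem_zrange.
have pL : m \in zrange n.+1 by rewrite mem_zrange; lia.
have qL : m + 1 \in zrange n.+1 by rewrite mem_zrange; lia.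
have asc : pos w m < pos w (m + 1).
  by apply: (ascP (D := typeA n) mI dw); rewrite inE.
(* With [m] first, the sign is -1 at [m] and 1 at [m + 1], so no inversion straddles this pair. *)
have := aligned_adjacent al (fun _ _ => isT) pL qL _ _ _ asc xL yL.
rewrite /= /kapA => h; case: (ltP m x) => mx; case: (ltP m y) => my //; try lia.
have : pos w x <= pos w y.
  apply: h => //; try lia.
    by move=> i k t; rewrite /formA /bar before_headF.
  by move=> i k t; rewrite /formA /bar addrK before_head //; lia.
by rewrite leNgt inv.
Defined.

(** Only the letters [j - 1] and [j] move [j]: its position in c is below [j] if [j - 1] comes first
    and above [j] otherwise. *)
Lemma before_invA e f j : perm_eq e (zrange n) -> perm_eq f (zrange n) ->
  wprod (typeA n) f = wprod (typeA n) e -> 2 <= j <= n%:Z ->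
  before e (j - 1) j = before f (j - 1) j.
Proof.
have key g : perm_eq g (zrange n) -> 2 <= j <= n%:Z ->
    before g (j - 1) j = (pos (wprod (typeA n) g) j < j).
  move=> gI hj; have jI : j \in zrange n by rewrite mem_zrange; lia.
  have jI' : j - 1 \in zrange n by rewrite mem_zrange; lia.
  have jL : j \in zrange n.+1 by rewrite mem_zrange; lia.
  have fx : {in zrange n, forall r, r != j - 1 -> r != j -> ev (sA n r) j = j}.
    by move=> r rI h1 h2; rewrite ev_sA //; split_ifs.
  have [b|] := boolP (before g (j - 1) j).
    have := kap_pos_before (D := typeA n) gI jI' jL fx b.
    by rewrite /= /kapA ev_sA //; split_ifs.
  rewrite -before_total ?(perm_mem gI) //; last lia.
  have fx' : {in zrange n, forall r, r != j -> r != j - 1 -> ev (sA n r) j = j}.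
    by move=> r rI h1 h2; exact: fx.
  move=> /(kap_pos_before (D := typeA n) gI jI jL fx').
  by rewrite /= /kapA ev_sA //; split_ifs.
by move=> eI fI E hj; rewrite !key // E.
Qed.

End OrientationA.

(** It remains to read [formA] as the barring: negative values are upper bars and give (A1),
    positive values are lower bars and give (A2). *)
Lemma sortable_condA n (c : permA n) a w :
  coxeter_element (SA n) c -> reduced_word (SA n) c a ->
  (c_sortable (SA n) a w <-> condA c w).
Proof.
move=> cc ra; have [e eI [Ea Ec]] := coxeter_word (D := typeA n) cc ra; subst a c.
have pre (i j : int) : 1 <= i <= n%:Z -> 1 <= j <= n%:Z -> (i == j - 1) || (j == i - 1) ->
    precedes (SA n) (wprod (typeA n) e) (sA n i) (sA n j) <-> before e i j.
  move=> hi hj adj.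
  have iI : i \in zrange n by rewrite mem_zrange.
  have jI : j \in zrange n by rewrite mem_zrange.
  have ij : i != j by lia.
  apply: (precedesP (D := typeA n) eI ra cc iI jI ij) => f fI E.
  case/orP: adj => /eqP ?; subst.
    by rewrite -(before_invA eI fI E) //; lia.
  rewrite (before_total (i := i - 1)) ?(perm_mem eI) //; last lia.
  rewrite (before_total (i := i - 1)) ?(perm_mem fI) //; last lia.
  by rewrite -(before_invA eI fI E) //; lia.
rewrite -[SA n]/(gens (typeA n)).
apply: (iff_trans (sortable_aligned (orientA n) eI (isT : grp (typeA n) w))).
have sl := subseq_one_line w (zrange_sorted n.+1).
split=> [al|[cA1 cA2] i j k /tripleA t].
  split=> i j k ijk [hj pj] /sl [[h1 h2 h3] h];
    have t : triple (typeA n) i j k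
      by (apply/tripleA; move: h1 h2 h3; rewrite !mem_zrange; lia).
    have bj : before e j (j - 1) by apply/pre => //; lia.
    have [+ _] := al _ _ _ t; rewrite /= /formA /bar.
    rewrite (before_total (i := j)) ?bj ?h ?(perm_mem eI) ?mem_zrange //; try lia.
    by move/(_ isT).
  have bj : before e (j - 1) j by apply/pre => //; lia.
  have [_ +] := al _ _ _ t; rewrite /= /formA /bar bj h.
  by move/(_ isT).
rewrite /= /formA /bar.
have jI : j - 1 \in e by rewrite (perm_mem eI) mem_zrange; lia.
split; case: ifP => // b _; apply/negP => h.
  apply: (cA1 i j k); first lia.
    split; first lia; apply/pre; try lia.
    by rewrite (before_total jI) ?b //; lia.
  by apply/sl; split=> //; split; rewrite mem_zrange; lia.
apply: (cA2 i j k); first lia.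
  by split; first lia; apply/pre; try lia.
by apply/sl; split=> //; split; rewrite mem_zrange; lia.
Qed.

(** * Signed permutations *)

Section SignedPermutations.

Variable n : nat.
Notation L := (pm_range n).
Implicit Types (m x : int) (w : permPM n).

Lemma mem_pm x : (x \in L) = (x != 0) && (- n%:Z <= x <= n%:Z).
Proof.
rewrite mem_cat mem_zrange.
have -> : (x \in [seq - i | i <- rev (zrange n)]) = (- x \in zrange n).
  apply/mapP/idP => [[i + ->]|h]; first by rewrite mem_rev opprK.
  by exists (- x); rewrite ?mem_rev ?opprK.
by rewrite mem_zrange; lia.
Qed.

Lemma mem_pmN x : (- x \in L) = (x \in L).
Proof. by rewrite !mem_pm; lia. Qed.

Lemma pm_sorted : sorted <%R L.
Proof.
rewrite /pm_range (sorted_pairwise (@lt_trans _ _)) pairwise_cat.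
rewrite -!(sorted_pairwise (@lt_trans _ _)) zrange_sorted andbT; apply/andP; split.
  apply/allrelP => x y /mapP [i]; rewrite mem_rev !mem_zrange; lia.
rewrite sorted_map rev_sorted.
by apply: sub_sorted (zrange_sorted n) => x y /=; lia.
Qed.

Lemma pm_uniq : uniq L.
Proof. exact: (sorted_uniq (@lt_trans _ _) (@ltxx _ _) pm_sorted). Qed.

Lemma signedP w : reflect (forall x, ev w (- x) = - ev w x) (signed w).
Proof.
apply: (iffP allP) => h x; last by move=> _; rewrite h.
have [xL|xL] := boolP (x \in L); first exact/eqP/h.
by rewrite !ev_out ?mem_pmN.
Qed.

Lemma pos_signed w x : signed w -> pos w (- x) = - pos w x.
Proof. by move=> /signedP h; apply: (@ev_inj _ w); rewrite h /pos !evVK. Qed.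

Lemma signed1 : signed (1%g : permPM n).
Proof. by apply/signedP => x; rewrite !ev1. Qed.

Lemma signedM u v : signed u -> signed v -> signed (u * v : permPM n)%g.
Proof. by move=> /signedP hu /signedP hv; apply/signedP => x; rewrite !evM hu hv. Qed.

Definition zidx : seq int := [seq i%:Z | i <- iota 0 n].

Lemma mem_zidx m : (m \in zidx) = (0 <= m < n%:Z).
Proof.
apply/mapP/idP => [[i] |h]; first by rewrite mem_iota => h ->; lia.
by exists `|m|%N; rewrite ?mem_iota; lia.
Qed.

Lemma zidx_uniq : uniq zidx.
Proof. by rewrite map_inj_uniq ?iota_uniq // => x y [->]. Qed.

End SignedPermutations.

(** * Type B *)

Section TypeB.

Variable n : nat.
Notation L := (pm_range n).
Implicit Types (m x : int) (e : seq int).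

Lemma ev_sB m x : m \in zidx n -> ev (sB n m) x =
  if m == 0 then if x == 1 then -1 else if x == -1 then 1 else x
  else if x == m then m + 1 else if x == m + 1 then m
  else if x == - m then - m - 1 else if x == - m - 1 then - m else x.
Proof.
rewrite mem_zidx /sB => mI; case: (eqVneq m 0) => m0.
  by rewrite ev_transp ?mem_pm; split_ifs.
by rewrite evM !ev_transp ?mem_pm; split_ifs.
Qed.

Definition kapB m x : int := if m < x then 1 else if x < - m then -1 else 0.

Definition simpleB m : seq (int * int) :=
  if m == 0 then [:: (-1, 1)] else [:: (m, m + 1); (- m - 1, - m)].

Lemma mem_simpleB m x y : ((x, y) \in simpleB m) =
  if m == 0 then (x == -1) && (y == 1)
  else ((x == m) && (y == m + 1)) || ((x == - m - 1) && (y == - m)).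
Proof. by rewrite /simpleB; case: ifP => _; rewrite !inE -!pair_eqE. Qed.

Lemma signed_sB m : m \in zidx n -> signed (sB n m).
Proof.
move=> mI; apply/signedP => x; rewrite !ev_sB //.
by move: mI; rewrite mem_zidx => ?; split_ifs.
Qed.

Lemma no_descB (w : permPM n) : signed w ->
  (forall m p, m \in zidx n -> p \in simpleB m -> pos w p.1 < pos w p.2) -> w = 1%g.
Proof.
move=> sw h.
have pN x : pos w (- x) = - pos w x by exact: pos_signed.
have inL (x : int) : 1 <= x <= n%:Z -> pos w x <= n%:Z.
  by move=> hx; have := pos_mem w x; rewrite !mem_pm; lia.
have id (x : int) : 1 <= x <= n%:Z -> pos w x = x.
  move=> hx; apply: (@mono_id 1 n%:Z (pos w)) => //.
  (* As 0 is no descent, [pos w 1] exceeds its opposite and is positive: the lower bound that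
     [mono_id] needs. *)
  - have : 0 \in zidx n by rewrite mem_zidx; lia.
    have aux (p : int) : - p < p -> 1 <= p by lia.
    by move/(h 0 (-1, 1)) => h0; apply: aux; rewrite -pN; apply: h0; rewrite mem_simpleB.
  - by apply: inL; lia.
  move=> y hy; apply: (h y (y, y + 1)); first by rewrite mem_zidx; lia.
  by rewrite mem_simpleB !eqxx; split_ifs.
apply: ev_extV => x; rewrite mem_pm invg1 ev1 => hx; rewrite -/(pos w x).
by case: (ltP 0 x) => x0; [apply: id; lia | rewrite -[x]opprK pN id ?opprK //; lia].
Qed.

(** The root of (-x, x) is denoted by this pair only, every other root by two pairs; the weight 2
    evens them out. *)
Definition typeB : realization L.
Proof.
apply: (@Realization L (zidx n) (sB n) (@signed n) (fun _ _ => true)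
  simpleB (fun x y => if y == - x then 2%N else 1%N) 2 kapB) => //.
- exact: pm_uniq.
- exact: zidx_uniq.
- exact: signed1.
- by move=> m w mI sw; apply: signedM => //; exact: signed_sB.
- by move=> m mI x; rewrite !ev_sB //; move: mI; rewrite mem_zidx => ?; split_ifs.
- move=> m; rewrite mem_zidx /simpleB => mI; case: ifP => // m0.
  by rewrite /= !inE -pair_eqE /=; lia.
- by move=> m x y; rewrite mem_zidx mem_simpleB !mem_pm => ?; split_ifs.
- move=> m mI x y; rewrite !mem_pm mem_simpleB !ev_sB // => ? ?.
  by move: mI; rewrite mem_zidx => ?; split_ifs.
- by move=> m x y mI; rewrite mem_simpleB ev_sB //; move: mI; rewrite mem_zidx => ?; split_ifs.
- move=> m mI x y _ _; congr (if _ then _ else _); rewrite !ev_sB //.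
  by move: mI; rewrite mem_zidx => ?; split_ifs.
- move=> m mI; rewrite /simpleB; case: ifP => m0; first by rewrite big_seq1.
  by rewrite !big_cons big_nil /=; move: mI m0; rewrite mem_zidx; split_ifs.
- move=> m w [x y] [x' y'] mI sw; rewrite !mem_simpleB /=.
  have pN z : pos w (- z) = - pos w z by exact: pos_signed.
  have pN1 : pos w (- m - 1) = - pos w (m + 1) by rewrite -pN; congr pos; lia.
  case: ifP => _; first by move=> /andP [/eqP -> /eqP ->] /andP [/eqP -> /eqP ->].
  by case/orP=> /andP [/eqP -> /eqP ->] /orP [] /andP [/eqP -> /eqP ->];
    rewrite ?pN1 ?pN; lia.
- exact: no_descB.
- by move=> m r mI rI mr x _; move: (mI) (rI); rewrite !mem_zidx ev_sB // /kapB => ? ?; split_ifs.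
- by move=> m x y; rewrite mem_zidx mem_simpleB /kapB => ?; split_ifs.
Defined.

Lemma gensB : gens typeB = SB n.
Proof. by rewrite /gens /SB /= /zidx -map_comp. Qed.

End TypeB.

(** * The orientation in type B *)

Section OrientationB.

Variable n : nat.
Notation L := (pm_range n).
Implicit Types (m x : int) (e b : seq int).

(** For nonzero [x] with |x| < n, negative means upper-barred and positive means lower-barred. *)
Definition barB e x : int := if 0 < x then bar e (x - 1) x else - bar e (- x - 1) (- x).

Lemma barBN e x : x != 0 -> barB e (- x) = - barB e x.
Proof.
move=> x0; rewrite /barB opprK; case: (ltP 0 x) => h; last first.
  by rewrite (_ : 0 < - x) ?opprK //; lia.
by rewrite (_ : (0 < - x) = false) //; lia.
Qed.

Lemma tripleB i j k : triple (typeB n) i j k <->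
  [/\ i \in L, j \in L & k \in L] /\ i < j < k.
Proof. by split=> [[]|[]]. Qed.

Section Rotate.

Variables (m : int) (b : seq int).
Hypothesis mb : perm_eq (m :: b) (zidx n).

Let u : uniq (m :: b). Proof. by rewrite (perm_uniq mb) zidx_uniq. Qed.

Let mI : m \in zidx n. Proof. by rewrite -(perm_mem mb) inE eqxx. Qed.

Let m0 : 0 <= m < n%:Z. Proof. by rewrite -mem_zidx. Qed.

Let tl (x : int) : 0 <= x < n%:Z -> x != m -> x \in b.
Proof. by rewrite -mem_zidx; exact: mem_tail. Qed.

Lemma barB_head1 : barB (m :: b) (m + 1) = 1.
Proof. by rewrite /barB /bar addrK before_head; split_ifs. Qed.

Lemma barB_head : 0 < m -> barB (m :: b) m = -1.
Proof. by move=> h; rewrite /barB h /bar before_headF. Qed.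

Lemma barB_last1 : m + 1 < n%:Z -> barB (rcons b m) (m + 1) = -1.
Proof.
move=> h; rewrite /barB /bar addrK before_lastF //; last by apply: tl; lia.
by split_ifs.
Qed.

Lemma barB_last : 0 < m -> barB (rcons b m) m = 1.
Proof. by move=> h; rewrite /barB h /bar before_last //; apply: tl; lia. Qed.

Lemma barB_other x : x != 0 -> `|x| < n%:Z -> `|x| != m -> `|x| != m + 1 ->
  barB (rcons b m) x = barB (m :: b) x.
Proof.
wlog x0 : x / 0 < x => [hw|].
  case: (ltP 0 x) => h; first exact: hw.
  move=> x1 x2 x3 x4; rewrite -[x]opprK barBN; last lia.
  by rewrite hw ?barBN; lia.
by move=> _ x1 x2 x3; rewrite /barB x0 /bar before_rot //; apply: tl; lia.
Qed.

(** s_m exchanges m and m + 1 while rotation reverses their barrings. For m = 0 the element 1 goes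
    to -1, and the reversal is absorbed by this sign. *)
Lemma barB_rot x : x != 0 -> `|x| < n%:Z -> `|ev (sB n m) x| < n%:Z ->
  barB (rcons b m) (ev (sB n m) x) = barB (m :: b) x.
Proof.
wlog x0 : x / 0 < x => [hw|].
  case: (ltP 0 x) => h; first exact: hw.
  have /signedP sN := signed_sB mI.
  move=> x1 x2 x3; have /hw : 0 < - x by lia.
  rewrite sN !barBN ?normrN //; first by move=> /(_ _ x2 x3); lia.
  by move: m0; rewrite ev_sB //; split_ifs.
move=> _ xn; rewrite ev_sB //; case: (eqVneq m 0) => [m00|mn0].
  case: (eqVneq x 1) => [x1 _|x1].
    rewrite x1 (_ : -1 = - (m + 1)); last lia.
    rewrite barBN ?barB_last1; try lia.
    by rewrite (_ : 1 = m + 1) ?barB_head1; lia.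
  by case: eqP => [|_ _]; [lia | rewrite barB_other //; lia].
case: eqP => [-> h|xm]; first by rewrite barB_last1 ?barB_head //; lia.
case: eqP => [-> _|xm1]; first by rewrite barB_last ?barB_head1 //; lia.
case: eqP => [|_]; first lia.
by case: eqP => [|_ _]; [lia | rewrite barB_other //; lia].
Qed.

End Rotate.

Definition formB e (i j k : int) : int := barB e j.

Definition orientB : orientation (typeB n).
Proof.
apply: (@Orientation _ (typeB n) formB).
- move=> m b i j k mb t nij njk; rewrite /formB.
  have mI : m \in zidx n by rewrite -(perm_mem mb) inE eqxx.
  have [[[aL bL cL] ijk' _] _] := triple_act (D := typeB n) mI t nij njk.
  case: t => -[iL jL kL] ijk _; move: iL jL kL aL bL cL ijk'; rewrite /= !mem_pm => *.
  by apply: barB_rot => //=; lia.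
- move=> m b i j k mb [[iL jL kL] ijk _] s; rewrite /formB.
  have mI : m \in zidx n by rewrite -(perm_mem mb) inE eqxx.
  move: mI iL jL kL s; rewrite mem_zidx !mem_pm mem_simpleB => m0 iL jL kL.
  case: ifP => m00; first move=> /andP [_ /eqP ?].
    by rewrite (_ : j = m + 1) ?(barB_head1 mb) ?(barB_last1 mb); lia.
  case/orP=> /andP [_ /eqP ?]; subst j.
    by rewrite (barB_head1 mb) (barB_last1 mb) //; lia.
  by rewrite !barBN ?barB_head ?(barB_last mb); lia.
- move=> m b i j k mb [[iL jL kL] ijk _] s; rewrite /formB.
  have mI : m \in zidx n by rewrite -(perm_mem mb) inE eqxx.
  move: mI iL jL kL s; rewrite mem_zidx !mem_pm mem_simpleB => m0 iL jL kL.
  case: ifP => m00; first move=> /andP [/eqP ? _].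
    by rewrite (_ : j = - (m + 1)) ?barBN ?(barB_head1 mb) ?(barB_last1 mb); lia.
  case/orP=> /andP [/eqP ? _]; subst j.
    by rewrite barB_head ?(barB_last mb) //; lia.
  by rewrite -opprD !barBN ?(barB_head1 mb) ?(barB_last1 mb); lia.
- move=> m b i j k mb [[iL jL kL] ijk _]; rewrite /= /formB /kapB => h.
  have mI : m \in zidx n by rewrite -(perm_mem mb) inE eqxx.
  move: mI iL jL kL; rewrite mem_zidx !mem_pm => m0 iL jL kL.
  by apply: (barB_other mb); try lia; move: h; split_ifs.
move=> m b w mb sw al dw x y xL yL xy _ inv.
have mI : m \in zidx n by rewrite -(perm_mem mb) inE eqxx.
have m0 : 0 <= m < n%:Z by rewrite -mem_zidx.
(* Both pairs denoting alpha_m have the signs that [aligned_adjacent] asks for when m > 0, and for m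
   = 0 the single pair does; an inversion that changes [kapB m] would straddle one of them. *)
have adj p q : (p, q) \in simpleB m -> x <= p -> q <= y -> pos w x <= pos w y.
  move=> s xp qy; have /andP [pL qL] := simple_mem (r0 := typeB n) mI s.
  have pq := simple_lt (D := typeB n) mI s; have asc := ascP (D := typeB n) mI dw s.
  apply: (aligned_adjacent al (fun _ _ => isT) pL qL pq _ _ asc xL yL xp qy).
    move=> i k [[]]; rewrite !mem_pm /= /formB => iL _ kL ik _.
    move: s; rewrite mem_simpleB; case: ifP => m00; first move=> /andP [/eqP ? _].
      by rewrite (_ : p = - (m + 1)) ?barBN ?(barB_head1 mb); lia.
    case/orP=> /andP [/eqP ? _]; subst p; first by rewrite barB_head //; lia.
    by rewrite -opprD !barBN ?(barB_head1 mb); lia.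
  move=> i k [[]]; rewrite !mem_pm /= /formB => iL _ kL ik _.
  move: s; rewrite mem_simpleB; case: ifP => m00; first move=> /andP [_ /eqP ?].
    by rewrite (_ : q = m + 1) ?(barB_head1 mb); lia.
  case/orP=> /andP [_ /eqP ?]; subst q; first by rewrite (barB_head1 mb) //; lia.
  by rewrite !barBN ?barB_head; lia.
have nadj p q : (p, q) \in simpleB m -> ~~ ((x <= p) && (q <= y)).
  by move=> s; apply/negP => /andP [h1 h2]; have := adj _ _ s h1 h2; rewrite leNgt inv.
move: xL yL; rewrite !mem_pm => xL yL.
have [m00|mn0] := eqVneq m 0.
  have := nadj (-1) 1; rewrite mem_simpleB m00 /= => /(_ isT).
  by rewrite /kapB; split_ifs.
have := nadj m (m + 1); have := nadj (- m - 1) (- m).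
rewrite !mem_simpleB (negbTE mn0) !eqxx orbT => /(_ isT) ? /(_ isT) ?.
by rewrite /= /kapB; split_ifs.
Defined.

Lemma before_invB e f j : perm_eq e (zidx n) -> perm_eq f (zidx n) ->
  wprod (typeB n) f = wprod (typeB n) e -> 1 <= j < n%:Z ->
  before e (j - 1) j = before f (j - 1) j.
Proof.
have key g : perm_eq g (zidx n) -> 1 <= j < n%:Z ->
    before g (j - 1) j = (pos (wprod (typeB n) g) j < j).
  move=> gI hj; have jI : j \in zidx n by rewrite mem_zidx; lia.
  have jI' : j - 1 \in zidx n by rewrite mem_zidx; lia.
  have jL : j \in L by rewrite mem_pm; lia.
  have fx : {in zidx n, forall r, r != j - 1 -> r != j -> ev (sB n r) j = j}.
    by move=> r rI h1 h2; rewrite ev_sB //; move: rI; rewrite mem_zidx => ?; split_ifs.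
  have [b|] := boolP (before g (j - 1) j).
    have := kap_pos_before (D := typeB n) gI jI' jL fx b.
    by rewrite /= /kapB ev_sB //; split_ifs.
  rewrite -before_total ?(perm_mem gI) //; last lia.
  have fx' : {in zidx n, forall r, r != j -> r != j - 1 -> ev (sB n r) j = j}.
    by move=> r rI h1 h2; exact: fx.
  move=> /(kap_pos_before (D := typeB n) gI jI jL fx').
  by rewrite /= /kapB ev_sB //; split_ifs.
by move=> eI fI E hj; rewrite !key // E.
Qed.

End OrientationB.

Lemma sortable_condB n (c : permPM n) a w :
  coxeter_element (SB n) c -> reduced_word (SB n) c a -> w \in WB n ->
  (c_sortable (SB n) a w <-> condB c w).
Proof.
rewrite inE -gensB => cc ra sw.
have [e eI [Ea Ec]] := coxeter_word (D := typeB n) cc ra; subst a c.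
have pre (i j : int) : 0 <= i < n%:Z -> 0 <= j < n%:Z -> (i == j - 1) || (j == i - 1) ->
    precedes (SB n) (wprod (typeB n) e) (sB n i) (sB n j) <-> before e i j.
  move=> hi hj adj; rewrite -gensB.
  have iI : i \in zidx n by rewrite mem_zidx.
  have jI : j \in zidx n by rewrite mem_zidx.
  have ij : i != j by lia.
  apply: (precedesP (D := typeB n) eI ra cc iI jI ij) => f fI E.
  case/orP: adj => /eqP ?; subst.
    by rewrite -(before_invB eI fI E) //; lia.
  rewrite (before_total (i := i - 1)) ?(perm_mem eI) //; last lia.
  rewrite (before_total (i := i - 1)) ?(perm_mem fI) //; last lia.
  by rewrite -(before_invB eI fI E) //; lia.
have up (j : int) : upperB (wprod (typeB n) e) j <->
    (j != 0) && (`|j| < n%:Z) && (barB e j < 0).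
  rewrite /upperB /posupperB /poslowerB; split.
    case=> -[hj] /pre h; have b := h ltac:(lia) ltac:(lia) ltac:(lia).
      move: b; rewrite (before_total (i := j - 1)) ?(perm_mem eI) ?mem_zidx; try lia.
      by rewrite /barB /bar => /negbTE ->; split_ifs.
    by rewrite /barB /bar b; split_ifs.
  case/andP=> /andP [j0 jn]; rewrite /barB /bar; case: (ltP 0 j) => jp; case: ifP => b // _.
    left; split; first lia; apply/pre; try lia.
    by rewrite (before_total (i := j - 1)) ?b ?(perm_mem eI) ?mem_zidx; lia.
  by right; split; first lia; apply/pre => //; lia.
apply: (iff_trans (sortable_aligned (orientB n) eI (sw : grp (typeB n) w))).
have sl := subseq_one_line w (pm_sorted n).
split=> [al i j k ijk /up uj /sl [m h]|cB].
  have t : triple (typeB n) i j k by case: m => *; apply/tripleB.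
  by have [+ _] := al _ _ _ t; rewrite /= /formB h => /(_ ltac:(lia)).
move=> i j k /tripleB [[iL jL kL] ijk]; rewrite /= /formB.
have jn : (j != 0) && (`|j| < n%:Z) by move: iL jL kL; rewrite !mem_pm; lia.
split=> b; apply/negP => h.
  by apply: (cB i j k) => //; [apply/up; rewrite jn | apply/sl].
(* Negating values and places turns the pattern k i j into (- j) (- i) (- k), whose middle value
   [- j] is upper-barred. *)
apply: (cB (- k) (- j) (- i)); first lia.
  by apply/up; rewrite barBN; lia.
by apply/sl; rewrite !mem_pmN !pos_signed //; split=> //; lia.
Qed.

Lemma odd_count_addb (T : Type) (P Q : pred T) s :
  odd (count (fun x => P x (+) Q x) s) = odd (count P s) (+) odd (count Q s).
Proof.
elim: s => //= x s IH; rewrite !oddD IH !oddb.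
by case: (P x); case: (Q x); case: (odd _); case: (odd _).
Qed.

(** * Type D *)

Section TypeD.

Variable n : nat.
Hypothesis hn : (2 <= n)%N.
Notation L := (pm_range n).
Implicit Types (m x : int) (e : seq int).

Lemma ev_sD m x : m \in zidx n -> ev (sD n m) x =
  if m == 0 then if x == 1 then -2 else if x == -2 then 1
                 else if x == 2 then -1 else if x == -1 then 2 else x
  else if x == m then m + 1 else if x == m + 1 then m
  else if x == - m then - m - 1 else if x == - m - 1 then - m else x.
Proof using hn.
rewrite mem_zidx /sD => mI; case: (eqVneq m 0) => m0.
  by rewrite evM !ev_transp ?mem_pm; split_ifs.
by rewrite evM !ev_transp ?mem_pm; split_ifs.
Qed.

(** The fundamental coweights at 0 and 1 are half the sum of all e_i and the same with e_1 negated;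
    they are doubled here. *)
Definition kapD m x : int :=
  if m == 0 then (if 0 < x then 1 else -1)
  else if m == 1 then (if (x == -1) || (1 < x) then 1 else -1) else kapB m x.

Definition simpleD m : seq (int * int) :=
  if m == 0 then [:: (-2, 1); (-1, 2)] else [:: (m, m + 1); (- m - 1, - m)].

Lemma mem_simpleD m x y : ((x, y) \in simpleD m) =
  if m == 0 then ((x == -2) && (y == 1)) || ((x == -1) && (y == 2))
  else ((x == m) && (y == m + 1)) || ((x == - m - 1) && (y == - m)).
Proof. by rewrite /simpleD; case: ifP => _; rewrite !inE -!pair_eqE. Qed.

Lemma signed_sD m : m \in zidx n -> signed (sD n m).
Proof using hn.
move=> mI; apply/signedP => x; rewrite !ev_sD //.
by move: mI; rewrite mem_zidx => ?; split_ifs.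
Qed.

Lemma perm_abs (w : permPM n) : signed w ->
  perm_eq [seq `|ev w i| | i <- zrange n] (zrange n).
Proof.
move=> /signedP sw; have u : uniq [seq `|ev w i| | i <- zrange n].
  rewrite map_inj_in_uniq ?zrange_uniq // => x y; rewrite !mem_zrange => hx hy E.
  have [/ev_inj|] : ev w x = ev w y \/ ev w x = ev w (- y) by rewrite sw; lia.
    by [].
  by move/ev_inj; lia.
apply: uniq_perm (zrange_uniq n) _ => //.
have sub : {subset [seq `|ev w i| | i <- zrange n] <= zrange n}.
  move=> x /mapP [i iL ->]; have := ev_mem w i; move: iL.
  by rewrite !mem_zrange !mem_pm; lia.
by have [|] := uniq_min_size u sub; rewrite ?size_map.
Qed.

Lemma count_le2 : count (fun x : int => x <= 2) (zrange n) = 2.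
Proof using hn.
case: n hn => [|[|k]] // _.
have -> : zrange k.+2 = 1%N%:Z :: 2%N%:Z :: [seq i%:Z | i <- iota 3 k] by [].
rewrite /= (_ : count _ _ = 0%N) //; apply/eqP; rewrite -leqn0 leqNgt -has_count.
by apply/hasPn => x /mapP [i]; rewrite mem_iota; lia.
Qed.

(** The letter 0 changes the sign of the entries of absolute value at most 2. There are two of them,
    so the parity is kept; the other letters change no sign. *)
Lemma WD_gen m (w : permPM n) : m \in zidx n -> w \in WD n -> (w * sD n m)%g \in WD n.
Proof using hn.
move=> mI; rewrite !inE => /andP [sw ow]; rewrite signedM ?signed_sD //=.
have mn : 0 <= m < n%:Z by rewrite -mem_zidx.
have [m0|m0] := eqVneq m 0; last first.
  rewrite (eq_in_count (a2 := fun i => ev w i < 0)) // => i _.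
  by rewrite evM ev_sD //; split_ifs.
have := odd_count_addb (fun i => ev w i < 0) (fun i => `|ev w i| <= 2) (zrange n).
rewrite -(count_map (fun i => `|ev w i|) (fun x => x <= 2)).
rewrite (seq.permP (perm_abs sw)) count_le2 addbF (negbTE ow) => E.
rewrite (eq_in_count (a2 := fun i => (ev w i < 0) (+) (`|ev w i| <= 2))) ?E // => i iL.
have := ev_mem w i; move: iL; rewrite mem_zrange !mem_pm evM ev_sD // => h1 h2.
by split_ifs.
Qed.

(** The letters 0 and 1 give |pos w 1| < pos w 2, so 2, ..., n are fixed by [mono_id] and pos w 1 is
    1 or -1; evenness rules out -1. *)
Lemma no_descD (w : permPM n) : w \in WD n ->
  (forall m p, m \in zidx n -> p \in simpleD m -> pos w p.1 < pos w p.2) -> w = 1%g.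
Proof using hn.
rewrite inE => /andP [sw ow] h.
have pN x : pos w (- x) = - pos w x by exact: pos_signed.
have inL (x : int) : 1 <= x <= n%:Z -> (pos w x != 0) && (`|pos w x| <= n%:Z).
  by move=> hx; have := pos_mem w x; rewrite !mem_pm; lia.
have h0 : - pos w 2 < pos w 1.
  by rewrite -pN; apply: (h 0 (-2, 1)); rewrite ?mem_zidx ?mem_simpleD //; lia.
have h1 : pos w 1 < pos w 2.
  by apply: (h 1 (1, 2)); rewrite ?mem_zidx ?mem_simpleD //; lia.
have p10 : pos w 1 != 0 by have /andP [] := inL 1 ltac:(lia).
have id (x : int) : 2 <= x <= n%:Z -> pos w x = x.
  move=> hx; apply: (@mono_id 2 n%:Z (pos w)) => //.
  - have aux (p q : int) : - q < p -> p < q -> p != 0 -> 2 <= q by lia.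
    exact: aux h0 h1 p10.
  - by have := inL n%:Z; lia.
  move=> y hy; apply: (h y (y, y + 1)); first by rewrite mem_zidx; lia.
  by rewrite mem_simpleD !eqxx; split_ifs.
have p1n : `|pos w 1| <= n%:Z by have /andP [] := inL 1 ltac:(lia).
(* An absolute value of at least 2 is its own position, so 1 cannot have that position or its
   opposite. *)
have p1 : `|pos w 1| = 1.
  apply/eqP; apply: contraTT isT => ne.
  have E : pos w `|pos w 1| = `|pos w 1| by apply: id; lia.
  have [e|e] : pos w 1 = `|pos w 1| \/ pos w 1 = - `|pos w 1| by lia.
    by move: E; rewrite -{2}e => /pos_inj; lia.
  have := pN `|pos w 1|; rewrite E -e => /pos_inj; lia.
have p1E : pos w 1 = 1.
  apply/eqP; apply: contraTT ow => ne; have e1 : pos w 1 = -1 by lia.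
  have E : ev w 1 = -1.
    have := congr1 (ev w) e1; rewrite /pos evVK (signedP _ sw) => h'.
    by apply: oppr_inj; rewrite opprK -h'.
  have zE : zrange n = 1 :: [seq i%:Z | i <- iota 2 n.-1] by case: n hn.
  rewrite zE /= E (_ : count _ _ = 0%N) //; apply/eqP; rewrite -leqn0 leqNgt -has_count.
  apply/hasPn => x /mapP [i]; rewrite mem_iota => hi ->.
  have Ei : pos w i%:Z = i%:Z by apply: id; lia.
  by rewrite -Ei /pos evVK.
have id1 (x : int) : 1 <= x <= n%:Z -> pos w x = x.
  by move=> hx; case: (eqVneq x 1) => [-> //|?]; apply: id; lia.
apply: ev_extV => x; rewrite mem_pm invg1 ev1 => hx; rewrite -/(pos w x).
by case: (ltP 0 x) => x0; [apply: id1; lia | rewrite -[x]opprK pN id1 ?opprK //; lia].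
Qed.

Definition typeD : realization L.
Proof using hn.
apply: (@Realization L (zidx n) (sD n) (fun w => w \in WD n)
  (fun x y => (x != y) && (x != - y)) simpleD (fun _ _ => 1%N) 2 kapD) => //.
- exact: pm_uniq.
- exact: zidx_uniq.
- by rewrite inE signed1 (eq_in_count (a2 := pred0)) ?count_pred0 // => x;
    rewrite mem_zrange ev1 /= => ?; lia.
- exact: WD_gen.
- by move=> m mI x; rewrite !ev_sD //; move: mI; rewrite mem_zidx => ?; split_ifs.
- by move=> x y; lia.
- by move=> m mI x y _ _; rewrite !ev_sD //; move: mI; rewrite mem_zidx => ?; split_ifs.
- move=> m; rewrite mem_zidx /simpleD => mI; case: ifP => // m0.
  by rewrite /= !inE -pair_eqE /=; lia.
- by move=> m x y; rewrite mem_zidx mem_simpleD !mem_pm => ?; split_ifs.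
- move=> m mI x y; rewrite !mem_pm mem_simpleD !ev_sD // => ? ?.
  by move: mI; rewrite mem_zidx => ?; split_ifs.
- by move=> m x y mI; rewrite mem_simpleD ev_sD //; move: mI; rewrite mem_zidx => ?; split_ifs.
- by move=> m mI; rewrite /simpleD; case: ifP => m0; rewrite !big_cons big_nil.
- move=> m w [x y] [x' y'] mI; rewrite inE => /andP [sw _]; rewrite !mem_simpleD /=.
  have pN z : pos w (- z) = - pos w z by exact: pos_signed.
  have pN1 : pos w (- m - 1) = - pos w (m + 1) by rewrite -pN; congr pos; lia.
  by case: ifP => _; case/orP=> /andP [/eqP -> /eqP ->] /orP [] /andP [/eqP -> /eqP ->];
    rewrite ?pN1 ?pN ?ltrN2 // ltrNr.
- exact: no_descD.
- move=> m r mI rI mr x; move: (mI) (rI).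
  by rewrite !mem_zidx mem_pm ev_sD // /kapD /kapB => ? ? ?; split_ifs.
- by move=> m x y; rewrite mem_zidx mem_simpleD /kapD /kapB => ?; split_ifs.
Defined.

Lemma gensD : gens typeD = SD n.
Proof. by rewrite /gens /SD /= /zidx -map_comp. Qed.

End TypeD.

(* As e_1 = (alpha_0 - alpha_1) / 2 and e_2 = (alpha_0 + alpha_1) / 2, the values of
   omega_c are doubled; [barD] vanishes exactly at the central elements. *)
Definition pbarD e (x : int) : int :=
  if x == 1 then bar e 0 2 - bar e 1 2 else if x == 2 then bar e 0 2 + bar e 1 2
  else 2 * bar e (x - 1) x.

Definition barD e (x : int) : int := if 0 < x then pbarD e x else - pbarD e (- x).

(** In the bilinear expansion of omega_c(e_j - e_i, e_k - e_j) the barring of [j] decides the sign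
    unless [j] is central. Then only - omega_c(e_i, e_k) is left, governed by the one of [i] and [k]
    with the smaller absolute value. *)
Definition formD e (i j k : int) : int :=
  if barD e j != 0 then barD e j else if - k < i then - barD e i else - barD e k.

Lemma bar_sign e i j : (bar e i j == 1) || (bar e i j == -1).
Proof. by rewrite /bar; case: ifP. Qed.

Lemma barDN e (x : int) : x != 0 -> barD e (- x) = - barD e x.
Proof.
move=> x0; rewrite /barD opprK; case: (ltP 0 x) => h; last first.
  by rewrite (_ : 0 < - x) ?opprK //; lia.
by rewrite (_ : (0 < - x) = false) //; lia.
Qed.

Lemma barD1 e : barD e 1 = bar e 0 2 - bar e 1 2. Proof. by []. Qed.

Lemma barD2 e : barD e 2 = bar e 0 2 + bar e 1 2. Proof. by []. Qed.

Lemma barD_ge3 e (x : int) : 3 <= x -> barD e x = 2 * bar e (x - 1) x.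
Proof. by move=> h; rewrite /barD /pbarD; split_ifs. Qed.

Lemma barD_neq0 e (x : int) : (3 <= x) || (x <= -3) -> barD e x != 0.
Proof.
wlog x0 : x / 0 < x => [hw|h].
  case: (ltP 0 x) => h x3; first exact: hw.
  have := hw (- x); rewrite barDN; lia.
by rewrite barD_ge3; [have := bar_sign e (x - 1) x; lia | lia].
Qed.

(** The two signs are equal or opposite, so exactly one of 1 and 2 is central. *)
Lemma barD_small e : (barD e 1 == 0) = (barD e 2 != 0).
Proof. by rewrite barD1 barD2; have := bar_sign e 0 2; have := bar_sign e 1 2; lia. Qed.

(** The triple (- k, - j, - i) denotes the same two roots in the opposite order, and omega_c is
    skew-symmetric. *)
Lemma formDN e (i j k : int) : i != 0 -> j != 0 -> k != 0 -> i != - k ->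
  formD e (- k) (- j) (- i) = - formD e i j k.
Proof.
by move=> i0 j0 k0 ik; rewrite /formD !barDN // !opprK; split_ifs.
Qed.

(** * Barrings of type D under rotation *)

Section OrientationD.

Variable n : nat.
Hypothesis hn : (2 <= n)%N.
Notation L := (pm_range n).
Notation typeD := (typeD hn).
Implicit Types (m x : int) (e b : seq int).

Lemma tripleD i j k : triple typeD i j k <->
  [/\ i \in L, j \in L & k \in L] /\
  [&& i < j, j < k, i != - j, j != - k & i != - k].
Proof.
split=> [[h ijk [r1 r2 r3]]|[h ijk]]; split=> //=; first by rewrite /= in r1 r2 r3; lia.
  lia.
by split; lia.
Qed.

Section Rotate.

Variables (m : int) (b : seq int).
Hypothesis mb : perm_eq (m :: b) (zidx n).

Let u : uniq (m :: b). Proof. by rewrite (perm_uniq mb) zidx_uniq. Qed.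

Let mI : m \in zidx n. Proof. by rewrite -(perm_mem mb) inE eqxx. Qed.

Let m0 : 0 <= m < n%:Z. Proof. by rewrite -mem_zidx. Qed.

Let tl (x : int) : 0 <= x < n%:Z -> x != m -> x \in b.
Proof. by rewrite -mem_zidx; exact: mem_tail. Qed.

Lemma bar_rot (i j : int) : 0 <= i < n%:Z -> 0 <= j < n%:Z -> i != m -> j != m ->
  bar (rcons b m) i j = bar (m :: b) i j.
Proof. by move=> *; rewrite /bar before_rot //; apply: tl. Qed.

Lemma bar_headl (j : int) : j != m -> bar (m :: b) m j = 1.
Proof. by move=> h; rewrite /bar before_head. Qed.

Lemma bar_headr i : bar (m :: b) i m = -1.
Proof. by rewrite /bar before_headF. Qed.

Lemma bar_lastl (j : int) : 0 <= j < n%:Z -> j != m -> bar (rcons b m) m j = -1.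
Proof. by move=> *; rewrite /bar before_lastF //; apply: tl. Qed.

Lemma bar_lastr (i : int) : 0 <= i < n%:Z -> i != m -> bar (rcons b m) i m = 1.
Proof. by move=> *; rewrite /bar before_last //; apply: tl. Qed.

(** A leading [m] precedes its neighbours and a trailing one follows them. For m = 2 both 0 and 1
    are lower neighbours, and their two signs add up to the same value. *)
Lemma barD_large : 2 <= m ->
  [/\ barD (m :: b) m = -2, barD (rcons b m) m = 2, barD (m :: b) (m + 1) = 2
    & m + 1 < n%:Z -> barD (rcons b m) (m + 1) = -2].
Proof.
move=> m2; rewrite !(barD_ge3 _ (x := m + 1)); try lia.
rewrite !addrK bar_headl; last lia; split=> //.
- have [e2|ne2] := eqVneq m 2.
    have hr i : bar (m :: b) i 2 = -1 by rewrite -e2 bar_headr.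
    by rewrite [X in barD _ X]e2 barD2 !hr.
  by rewrite barD_ge3 ?bar_headr //; lia.
- have [e2|ne2] := eqVneq m 2.
    have hr (i : int) : 0 <= i < n%:Z -> i != m -> bar (rcons b m) i 2 = 1.
      by rewrite -e2; exact: bar_lastr.
    by rewrite [X in barD _ X]e2 barD2 !hr //; lia.
  by rewrite barD_ge3 ?bar_lastr //; lia.
by move=> h; rewrite bar_lastl //; lia.
Qed.

Lemma barD_center2 : m = 2 -> barD (m :: b) 1 = 0 /\ barD (rcons b m) 1 = 0.
Proof.
move=> e2; have hr i : bar (m :: b) i 2 = -1 by rewrite -e2 bar_headr.
have hl (i : int) : 0 <= i < n%:Z -> i != m -> bar (rcons b m) i 2 = 1.
  by rewrite -e2; exact: bar_lastr.
by rewrite !barD1 !hr !hl ?subrr //; lia.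
Qed.

(** [v] is the sign for the letters 0 and 2, which moving the letter 1 does not affect. One of
    [v - 1] and [v + 1] vanishes, so rotation exchanges which of 1 and 2 is central. *)
Lemma barD_head1 : m = 1 -> 3 <= n%:Z -> exists2 v : int, (v == 1) || (v == -1)
  & [/\ barD (m :: b) 1 = v - 1, barD (m :: b) 2 = v + 1,
        barD (rcons b m) 1 = v + 1 & barD (rcons b m) 2 = v - 1].
Proof.
move=> e1 n3; exists (bar (m :: b) 0 2); first exact: bar_sign.
have h1 : bar (m :: b) 1 2 = 1 by rewrite -e1 bar_headl //; lia.
have h2 : bar (rcons b m) 1 2 = -1 by rewrite -e1 bar_lastl //; lia.
by rewrite !barD1 !barD2 h1 h2 bar_rot ?opprK //; lia.
Qed.

Lemma barD_head0 : m = 0 -> 3 <= n%:Z -> exists2 v : int, (v == 1) || (v == -1)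
  & [/\ barD (m :: b) 1 = 1 - v, barD (m :: b) 2 = 1 + v,
        barD (rcons b m) 1 = - 1 - v & barD (rcons b m) 2 = - 1 + v].
Proof.
move=> e0 n3; exists (bar (m :: b) 1 2); first exact: bar_sign.
have h1 : bar (m :: b) 0 2 = 1 by rewrite -e0 bar_headl //; lia.
have h2 : bar (rcons b m) 0 2 = -1 by rewrite -e0 bar_lastl //; lia.
by rewrite !barD1 !barD2 h1 h2 bar_rot //; lia.
Qed.

(** The last clause is there because the letters 0 and 1 enter the barrings of both 1 and 2. *)
Lemma barD_other x : [&& x != 0, - n%:Z < x, x < n%:Z, x != m, x != - m, x != m + 1,
    x != - m - 1 & [|| 2 <= m, 3 <= x | x <= -3]] -> barD (rcons b m) x = barD (m :: b) x.
Proof.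
wlog x0 : x / 0 < x => [hw|].
  case: (ltP 0 x) => h; first exact: hw.
  move=> hx; rewrite -[x]opprK barDN; last lia.
  rewrite hw ?barDN; lia.
move=> hx; have [x5|] := leP 3 x.
  by rewrite !barD_ge3 // bar_rot //; lia.
have [e1|ne1] := eqVneq x 1.
  have [e2|ne2] := eqVneq m 2.
    by rewrite e1 (barD_center2 e2).1 (barD_center2 e2).2.
  by rewrite e1 !barD1 !bar_rot //; lia.
move=> x5; have -> : x = 2 by lia.
by rewrite !barD2 !bar_rot //; lia.
Qed.

Lemma barD_rot x : 3 <= n%:Z -> (x != 0) && (- n%:Z < x < n%:Z) ->
  - n%:Z < ev (sD n m) x < n%:Z ->
  barD (rcons b m) (ev (sD n m) x) = barD (m :: b) x.
Proof.
move=> n3; wlog x0 : x / 0 < x => [hw|].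
  case: (ltP 0 x) => h; first exact: hw.
  have /signedP sN := signed_sD hn mI.
  move=> x1 x3; have /hw : 0 < - x by lia.
  rewrite sN !barDN; first by move=> h'; apply: oppr_inj; apply: h'; lia.
    by lia.
  by move: m0; rewrite ev_sD //; split_ifs.
move=> xn; rewrite ev_sD //; case: (eqVneq m 0) => [m00|mn0].
  have [v _ [h1 h2 h1' h2']] := barD_head0 m00 n3.
  case: (eqVneq x 1) => [-> _|x1]; first by rewrite barDN // h2' h1; lia.
  case: eqP => [|_]; first lia.
  case: (eqVneq x 2) => [-> _|x2]; first by rewrite barDN // h1' h2; lia.
  by case: eqP => [|_ _]; [lia | rewrite barD_other //; lia].
case: (eqVneq m 1) => [m1|mn1].
  have [v _ [h1 h2 h1' h2']] := barD_head1 m1 n3.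
  case: eqP => [-> h|xm]; first by rewrite [X in _ = barD _ X]m1 [X in barD _ (X + 1)]m1 h2' h1.
  case: eqP => [-> h|xm1]; first by rewrite [X in _ = barD _ (X + 1)]m1 [X in barD _ X]m1 h1' h2.
  case: eqP => [|_]; first lia.
  by case: eqP => [|_ _]; [lia | rewrite barD_other //; lia].
have [|h1 h2 h3 h4] := barD_large; first lia.
case: eqP => [-> h|xm]; first by rewrite h4 ?h1 //; lia.
case: eqP => [-> _|xm1]; first by rewrite h2 h3.
case: eqP => [|_]; first lia.
by case: eqP => [|_ _]; [lia | rewrite barD_other //; lia].
Qed.

End Rotate.
End OrientationD.

(** * The form of type D under rotation *)

Section AlignmentD.

Variable n : nat.
Hypothesis hn : (2 <= n)%N.
Notation L := (pm_range n).
Notation typeD := (typeD hn).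
Implicit Types (m x : int) (e b : seq int).

Lemma tripleD_bounds i j k : triple typeD i j k ->
  [/\ 3 <= n%:Z, [&& i != 0, j != 0, k != 0, - n%:Z <= i & k <= n%:Z]
    & [&& i < j, j < k, i != - j, j != - k & i != - k]].
Proof. by case/tripleD => -[]; rewrite !mem_pm; split; lia. Qed.

(** [barD_rot] transports the barrings. For central [j], s_m may still change which of [i] and [k]
    is smaller in absolute value; then these absolute values are m and m + 1, and both readings
    agree. *)
Lemma formD_gen m b i j k : perm_eq (m :: b) (zidx n) -> triple typeD i j k ->
  (i, j) \notin simpleD m -> (j, k) \notin simpleD m ->
  formD (rcons b m) (ev (sD n m) i) (ev (sD n m) j) (ev (sD n m) k)
  = formD (m :: b) i j k.
Proof.
move=> mb t nij njk; have [n3 iB ijk] := tripleD_bounds t.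
have mI : m \in zidx n by rewrite -(perm_mem mb) inE eqxx.
have m0 : 0 <= m < n%:Z by rewrite -mem_zidx.
have [/tripleD_bounds [_ iB' ijk'] _] := triple_act (D := typeD) mI t nij njk.
have {t nij njk} [[iL jL kL] _] := (tripleD hn _ _ _).1 t.
have rot x := @barD_rot n hn m b mb x n3.
have /signedP sN := signed_sD hn mI.
have smp x y := simpleE (r0 := typeD) mI (x := x) (y := y).
rewrite /= in iB' ijk' smp.
rewrite /formD rot; [|clear -iB ijk; lia|clear -iB' ijk'; lia].
case: ifP => // /negbFE /eqP Bj.
have j3 : (-3 < j < 3) by have := @barD_neq0 (m :: b) j; rewrite Bj; clear; lia.
have [h|h] := ltP (- k) i; have [h'|h'] := ltP (- ev (sD n m) k) (ev (sD n m) i).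
- by rewrite rot //; [clear -iB ijk h; lia|clear -iB' ijk' h'; lia].
- have s : (- k, i) \in simpleD m.
    by rewrite smp ?mem_pmN //= h sN; clear -ijk h h' ijk'; lia.
  have [mk im m2] : [/\ k = m + 1, i = - m & 2 <= m].
    by move: s; rewrite mem_simpleD; clear -m0 ijk iB j3; case: ifP => ? ?; split; lia.
  have [h1 h2 _ _] := barD_large hn mb m2.
  have -> : ev (sD n m) k = m by rewrite ev_sD // mk; clear -m2; split_ifs.
  by rewrite h2 im barDN ?h1; clear -m2; lia.
- have s : (i, - k) \in simpleD m.
    by rewrite smp ?mem_pmN //= sN; clear -ijk h h' ijk'; lia.
  have [mk im m2] : [/\ k = m, i = - m - 1 & 2 <= m].
    by move: s; rewrite mem_simpleD; clear -m0 ijk iB j3; case: ifP => ? ?; split; lia.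
  have [h1 h2 _ _] := barD_large hn mb m2.
  have -> : ev (sD n m) i = - m by rewrite ev_sD // im; clear -m2; split_ifs.
  by rewrite barDN ?h2 ?mk ?h1; clear -m2; lia.
- by rewrite rot //; [clear -iB ijk h; lia|clear -iB' ijk' h'; lia].
Qed.

(** For m at most 1, [i] and [j] are 1 and 2 up to order and signs. One of them is central, and the
    form is read at the other. *)
Lemma formD_lo m b i j k : perm_eq (m :: b) (zidx n) -> triple typeD i j k ->
  (i, j) \in simpleD m ->
  (0 <= formD (m :: b) i j k) && (formD (rcons b m) i j k <= 0).
Proof.
move=> mb /tripleD_bounds [n3 iB ijk].
have mI : m \in zidx n by rewrite -(perm_mem mb) inE eqxx.
have {mI} m0 : 0 <= m < n%:Z by rewrite -mem_zidx.
rewrite mem_simpleD /formD.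
case: (eqVneq m 0) => [e0|ne0].
  have [v hv [h1 h2 h1' h2']] := barD_head0 hn mb e0 n3.
  case/orP=> /andP [/eqP ? /eqP ?]; subst i j; rewrite ?barDN // h1 h2 h1' h2'.
    by clear -hv iB ijk; split_ifs.
  by clear -hv iB ijk; split_ifs.
case: (eqVneq m 1) => [e1|ne1].
  have [v hv [h1 h2 h1' h2']] := barD_head1 hn mb e1 n3.
  case/orP=> /andP [/eqP ei /eqP ej].
    have {ei} ei : i = 1 by lia.
    have {ej} ej : j = 2 by lia.
    by subst i j; rewrite h1 h2 h1' h2'; clear -hv iB ijk; split_ifs.
  have {ei} ei : i = - 2 by lia.
  have {ej} ej : j = - 1 by lia.
  by subst i j; rewrite !barDN // h1 h2 h1' h2'; clear -hv iB ijk; split_ifs.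
have [|h1 h2 h3 h4] := barD_large hn mb; first by clear -m0 ne0 ne1; lia.
case/orP=> /andP [/eqP ? /eqP ?]; subst i j.
  by rewrite h3 h4 //; clear -iB ijk; lia.
by rewrite !barDN ?h1 ?h2 //; clear -ne0; lia.
Qed.

Lemma formD_hi m b i j k : perm_eq (m :: b) (zidx n) -> triple typeD i j k ->
  (j, k) \in simpleD m ->
  (formD (m :: b) i j k <= 0) && (0 <= formD (rcons b m) i j k).
Proof.
move=> mb t s; have [n3 iB ijk] := tripleD_bounds t.
have tN : triple typeD (- k) (- j) (- i).
  have [[iL jL kL] _] := (tripleD hn _ _ _).1 t.
  by apply/tripleD; rewrite !mem_pmN; split=> //; clear -ijk; lia.
have sN : (- k, - j) \in simpleD m by move: s; rewrite !mem_simpleD; clear; case: ifP => _; lia.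
have := formD_lo mb tN sN; rewrite !formDN; clear -iB ijk; lia.
Qed.

Lemma formD_kap m b i j k : perm_eq (m :: b) (zidx n) -> triple typeD i j k ->
  kapD m i = kapD m k -> formD (rcons b m) i j k = formD (m :: b) i j k.
Proof.
move=> mb /tripleD_bounds [n3 iB ijk].
have mI : m \in zidx n by rewrite -(perm_mem mb) inE eqxx.
have {mI} m0 : 0 <= m < n%:Z by rewrite -mem_zidx.
rewrite /kapD /kapB.
have ot x := @barD_other n hn m b mb x.
have [m1|m2] := ltP m 2; last first.
  rewrite (_ : (m == 0) = false); last by clear -m2; lia.
  rewrite (_ : (m == 1) = false); last by clear -m2; lia.
  move=> hk.
  have hij : ((m < i) && (m < k)) || ((i < - m) && (k < - m))
      || ((- m <= i <= m) && (- m <= k <= m)).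
    by move: hk; clear; split_ifs.
  rewrite /formD ot; last by clear -hij m2 iB ijk; lia.
  case: ifP => // /negbFE /eqP Bj.
  have j3 : (-3 < j < 3) by have := @barD_neq0 (m :: b) j; rewrite Bj; clear; lia.
  by case: ifP => h; rewrite ot //; clear -hij m2 iB ijk j3 h; lia.
case: (eqVneq m 0) => [e0|ne0].
  have [v hv [h1 h2 h1' h2']] := barD_head0 hn mb e0 n3 => hk.
  (* Equal [kapD] means that [i] and [k] have the same sign. For |j| at most 2 this leaves two
     cases, where rotation moves the reading of the form between [j] and the outer element of
     absolute value 1. *)
  have [j3|[[? ?]|[? ?]]] :
      ((3 <= j) || (j <= -3)) \/ (j = 2 /\ i = 1) \/ (j = - 2 /\ k = - 1).
  - by move: hk; clear -iB ijk; split_ifs.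
  - by rewrite /formD ot ?barD_neq0 //; clear -j3 m1 m0 iB ijk; lia.
  - by subst i j; rewrite /formD h1 h2 h1' h2'; clear -hv iB ijk; split_ifs.
  by subst j k; rewrite /formD !barDN // h1 h2 h1' h2'; clear -hv iB ijk; split_ifs.
have e1 : m = 1 by clear -m0 ne0 m1; lia.
have [v hv [h1 h2 h1' h2']] := barD_head1 hn mb e1 n3; rewrite [in X in X -> _]e1 /= => hk.
have [j3|[[? ?]|[? ?]]] :
    ((3 <= j) || (j <= -3)) \/ (j = 2 /\ i = - 1) \/ (j = - 2 /\ k = 1).
- by move: hk; clear -iB ijk; split_ifs.
- by rewrite /formD ot ?barD_neq0 //; clear -j3 m1 m0 iB ijk; lia.
- by subst i j; rewrite /formD !barDN // h1 h2 h1' h2'; clear -hv iB ijk; split_ifs.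
by subst j k; rewrite /formD !barDN // h1 h2 h1' h2'; clear -hv iB ijk; split_ifs.
Qed.


(** * Inversions crossing alpha_m in type D *)

Section Nocross.

Variables (m : int) (b : seq int) (w : permPM n).
Hypotheses (mb : perm_eq (m :: b) (zidx n)) (sw : signed w).
Hypothesis al : aligned typeD (formD (m :: b)) w.
Hypothesis asc : forall x y, (x, y) \in simpleD m -> pos w x < pos w y.

Let mI : m \in zidx n. Proof. by rewrite -(perm_mem mb) inE eqxx. Qed.

Let m0 : 0 <= m < n%:Z. Proof. by rewrite -mem_zidx. Qed.

Let pN x : pos w (- x) = - pos w x. Proof. exact: pos_signed. Qed.

Let tri i j k : i != 0 -> j != 0 -> k != 0 -> - n%:Z <= i -> k <= n%:Z ->
  [&& i < j, j < k, i != - j, j != - k & i != - k] -> triple typeD i j k.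
Proof.
move=> i0 j0 k0 iL kL h; apply/tripleD; rewrite !mem_pm.
by split=> //; split; clear -i0 j0 k0 iL kL h; lia.
Qed.

Lemma avoid_jki i j k : triple typeD i j k -> formD (m :: b) i j k < 0 ->
  pos w k < pos w i -> pos w k < pos w j.
Proof.
move=> t f ki; have [/(_ f) h _] := al t; rewrite ki andbT -leNgt in h.
rewrite lt_neqAle h andbT; apply/eqP => /pos_inj e; subst.
by case: t => _ /andP [_]; rewrite ltxx.
Qed.

Lemma avoid_kij i j k : triple typeD i j k -> 0 < formD (m :: b) i j k ->
  pos w i < pos w j -> pos w i <= pos w k.
Proof. by move=> t f ij; have [_ /(_ f)] := al t; rewrite ij andbT -leNgt. Qed.

(* For [x = - m], where (x, m, y) is not a triple of roots, the argument goes
   through [r = 1] or [r = -1] instead of [x]. *)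
Lemma nocross_large x y : 2 <= m -> x != 0 -> - n%:Z <= x <= m ->
  m + 1 <= y <= n%:Z -> x != - y -> pos w x <= pos w y.
Proof.
move=> m2 x0 xB yB xy; rewrite leNgt; apply/negP => yx.
have [h1 _ h3 _] := barD_large hn mb m2.
have pm : pos w m < pos w (m + 1).
  by apply: asc; rewrite mem_simpleD !eqxx; clear -m2; split_ifs.
have fm i k : formD (m :: b) i m k < 0 by rewrite /formD h1.
have ym : ~~ (pos w y < pos w m).
  rewrite -leNgt; have [->|ny] := eqVneq y (m + 1); first exact: ltW.
  apply: (@avoid_kij _ (m + 1)) => //; last by rewrite /formD h3.
  by apply: tri; clear -m2 yB ny m0; lia.
have low z : z != 0 -> - n%:Z <= z < m -> z != - m -> z != - y -> pos w y < pos w z -> False.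
  move=> z0 zB zm zy yz; case/negP: ym; apply: (@avoid_jki z) => //.
  by apply: tri; clear -m2 yB z0 zB zm zy m0; lia.
have [xm|xm] := eqVneq x m; first by rewrite xm (negbTE ym) in yx.
have [xm'|xm'] := eqVneq x (- m); last first.
  by apply: (low x) => //; clear -xB xm; lia.
have [r r1 fr] : exists2 r : int, (r == 1) || (r == -1) & formD (m :: b) (- m) r y < 0.
  have [u u1] : exists u : int, u = 1 by exists 1.
  (* The barrings of 1 and -1 are opposite; if they vanish, the form is read at [- m] and equals
     [barD] at [m], which is -2. *)
  have c : formD (m :: b) (- m) u y < 0 \/ formD (m :: b) (- m) (- u) y < 0.
    rewrite /formD !barDN; [|by clear -m2 u1; lia..].
    by rewrite h1; clear -m2 yB; split_ifs.
  by case: c => h; [exists u | exists (- u)] => //; rewrite u1.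
apply: (low r); try by clear -r1 m2 yB m0; lia.
apply: (avoid_jki _ fr); last by rewrite -xm'.
by apply: tri; clear -r1 m2 yB m0; lia.
Qed.

(** This serves m = 0 with p = -1 and m = 1 with p = 1. Both [p] and -2 stand before every z >= 3;
    if y >= 3 stood before x <= -3, an upper-barred one among [p] and -2 would give a forbidden
    pattern. Negation covers the rest. *)
Lemma nocross_small (p : int) : (p == 1) || (p == -1) ->
  (p, 2) \in simpleD m -> (- 2, - p) \in simpleD m ->
  (forall y, triple typeD p 2 y -> 0 < formD (m :: b) p 2 y) ->
  (forall y, triple typeD (- 2) (- p) y -> 0 < formD (m :: b) (- 2) (- p) y) ->
  (barD (m :: b) p < 0) || (barD (m :: b) (- 2) < 0) ->
  forall x y, x \in L -> y \in L -> x < y -> x != - y ->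
  [|| x == p, x == - 2 | x <= - 3] -> [|| y == 2, y == - p | 3 <= y] ->
  pos w x <= pos w y.
Proof.
move=> p1 s1 s2 f1 f2 fneg x y; rewrite !mem_pm => xL yL xy nxy xlo yhi.
have c1 (z : int) : 3 <= z <= n%:Z -> pos w p <= pos w z.
  move=> hz; have t : triple typeD p 2 z by apply: tri; clear -p1 hz; lia.
  exact: (avoid_kij t (f1 _ t) (asc s1)).
have c2 (z : int) : 3 <= z <= n%:Z -> pos w (- 2) <= pos w z.
  move=> hz; have t : triple typeD (- 2) (- p) z by apply: tri; clear -p1 hz; lia.
  exact: (avoid_kij t (f2 _ t) (asc s2)).
have [y3|y3] := leP 3 y.
  have yB : 3 <= y <= n%:Z by clear -y3 yL; lia.
  case/or3P: xlo => [/eqP ->|/eqP ->|x3]; [exact: c1 | exact: c2 |].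
  rewrite leNgt; apply/negP => yx.
  case/orP: fneg => f.
    have t : triple typeD x p y by apply: tri; clear -p1 x3 yB xL nxy; lia.
    have := avoid_jki t _ yx; rewrite /formD (ltr0_neq0 f) => /(_ f).
    by rewrite ltNge c1.
  have t : triple typeD x (- 2) y by apply: tri; clear -p1 x3 yB xL nxy; lia.
  have := avoid_jki t _ yx; rewrite /formD (ltr0_neq0 f) => /(_ f).
  by rewrite ltNge c2.
have [x3|x3] := leP x (- 3).
  have xB : 3 <= - x <= n%:Z by clear -x3 xL; lia.
  have [->|->] : y = 2 \/ y = - p by clear -yhi y3; lia.
    by have := c2 _ xB; rewrite !pN lerN2.
  by have := c1 _ xB; rewrite !pN lerNr.
have [[-> ->]|[-> ->]] : (x = p /\ y = 2) \/ (x = - 2 /\ y = - p).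
- by clear -xlo yhi x3 y3 nxy xy p1; lia.
- exact/ltW/asc.
exact/ltW/asc.
Qed.

End Nocross.

Lemma alignedD_nocross m b w : perm_eq (m :: b) (zidx n) -> w \in WD n ->
  aligned typeD (formD (m :: b)) w -> ~~ desc typeD m w -> nocross typeD m w.
Proof.
rewrite inE => mb /andP [sw _] al dw x y xL yL xy /andP [_ nxy] inv.
have mI : m \in zidx n by rewrite -(perm_mem mb) inE eqxx.
have m0 : 0 <= m < n%:Z by rewrite -mem_zidx.
have asc x' y' : (x', y') \in simpleD m -> pos w x' < pos w y'.
  exact: (ascP (D := typeD) mI dw).
have pN z : pos w (- z) = - pos w z by exact: pos_signed.
rewrite /= /kapD; case: (eqVneq m 0) => [e0|ne0].
  apply: contraTeq inv => hk; rewrite -leNgt.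
  have sm : forall p, (p == (-1, 2)) || (p == (- 2, - - 1)) -> p \in simpleD m.
    by move=> p; rewrite /simpleD e0 eqxx !inE => /orP [] ->; rewrite ?orbT.
  apply: (nocross_small sw al asc (p := -1)); rewrite ?sm //.
  - move=> z /tripleD_bounds [n3 zB zz].
    have [v hv [h1 h2 _ _]] := barD_head0 hn mb e0 n3.
    by rewrite /formD barDN // h1 h2; clear -hv zB zz; split_ifs.
  - move=> z /tripleD_bounds [n3 zB zz].
    have [v hv [h1 h2 _ _]] := barD_head0 hn mb e0 n3.
    by rewrite opprK /formD !barDN // h1 h2; clear -hv zB zz; split_ifs.
  - have h : bar (m :: b) 0 2 = 1 by rewrite -e0 bar_headl //; clear -e0; lia.
    by rewrite !barDN // barD1 barD2 h; have := bar_sign (m :: b) 1 2; clear; lia.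
  - by move: xL yL hk; rewrite !mem_pm; clear -xy nxy; split_ifs.
  - by move: xL yL hk; rewrite !mem_pm; clear -xy nxy; split_ifs.
case: (eqVneq m 1) => [e1|ne1].
  apply: contraTeq inv => hk; rewrite -leNgt.
  have sm : forall p, (p == (1, 2)) || (p == (- 2, - 1)) -> p \in simpleD m.
    by move=> p; rewrite /simpleD e1 !inE => /orP [] ->; rewrite ?orbT.
  apply: (nocross_small sw al asc (p := 1)); rewrite ?sm //.
  - move=> z /tripleD_bounds [n3 zB zz].
    have [v hv [h1 h2 _ _]] := barD_head1 hn mb e1 n3.
    by rewrite /formD h1 h2; clear -hv zB zz; split_ifs.
  - move=> z /tripleD_bounds [n3 zB zz].
    have [v hv [h1 h2 _ _]] := barD_head1 hn mb e1 n3.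
    by rewrite /formD !barDN // h1 h2; clear -hv zB zz; split_ifs.
  - have h : bar (m :: b) 1 2 = 1 by rewrite -e1 bar_headl //; clear -e1; lia.
    by rewrite barDN // barD1 barD2 h; have := bar_sign (m :: b) 0 2; clear; lia.
  - by move: xL yL hk; rewrite !mem_pm; clear -xy nxy; split_ifs.
  - by move: xL yL hk; rewrite !mem_pm; clear -xy nxy; split_ifs.
have m2 : 2 <= m by clear -m0 ne0 ne1; lia.
(* For m >= 2 an inversion crossing alpha_m, written as (x, y) or as (- y, - x), runs from at most
   [m] to at least [m + 1]. *)
have q1 : ~~ [&& x != 0, - n%:Z <= x <= m, m + 1 <= y <= n%:Z & x != - y].
  apply/negP => /and4P [a1 a2 a3 a4].
  by have := nocross_large mb al asc m2 a1 a2 a3 a4; rewrite leNgt inv.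
have q2 : ~~ [&& - y != 0, - n%:Z <= - y <= m, m + 1 <= - x <= n%:Z & - y != - - x].
  apply/negP => /and4P [a1 a2 a3 a4].
  by have := nocross_large mb al asc m2 a1 a2 a3 a4; rewrite !pN lerN2 leNgt inv.
move: xL yL; rewrite !mem_pm /kapB.
by clear -xy nxy m0 q1 q2; split_ifs.
Qed.

Definition orientD : orientation typeD :=
  @Orientation _ typeD formD formD_gen formD_lo formD_hi formD_kap alignedD_nocross.

End AlignmentD.

(** * Reading the order of letters off a Coxeter element of type D *)

Section CoxeterD.

Variable n : nat.
Hypothesis hn : (2 <= n)%N.
Notation L := (pm_range n).
Notation typeD := (typeD hn).
Notation wprod := (wprod typeD).
Implicit Types (m x : int) (e b : seq int).

Lemma before_invD e f j : perm_eq e (zidx n) -> perm_eq f (zidx n) ->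
  wprod f = wprod e -> 3 <= j < n%:Z -> before e (j - 1) j = before f (j - 1) j.
Proof.
have key g : perm_eq g (zidx n) -> 3 <= j < n%:Z ->
    before g (j - 1) j = (pos (wprod g) j < j).
  move=> gI hj; have jI : j \in zidx n by rewrite mem_zidx; lia.
  have jI' : j - 1 \in zidx n by rewrite mem_zidx; lia.
  have jL : j \in L by rewrite mem_pm; lia.
  have fx : {in zidx n, forall r, r != j - 1 -> r != j -> ev (sD n r) j = j}.
    by move=> r rI h1 h2; rewrite ev_sD //; move: rI; rewrite mem_zidx => ?; split_ifs.
  have [b|] := boolP (before g (j - 1) j).
    have := kap_pos_before (D := typeD) gI jI' jL fx b.
    by rewrite /= /kapD /kapB ev_sD //; clear -hj; split_ifs.
  rewrite -before_total ?(perm_mem gI) //; last lia.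
  have fx' : {in zidx n, forall r, r != j -> r != j - 1 -> ev (sD n r) j = j}.
    by move=> r rI h1 h2; exact: fx.
  move=> /(kap_pos_before (D := typeD) gI jI jL fx').
  by rewrite /= /kapD /kapB ev_sD //; clear -hj; split_ifs.
by move=> eI fI E hj; rewrite !key // E.
Qed.

(* [b0] and [b1] tell which of the commuting letters 0 and 1 occur. *)
Definition act01 (b0 b1 : bool) x : int :=
  if b0 then (if b1 then - x
              else if x == 1 then -2 else if x == 2 then -1
              else if x == -1 then 2 else if x == -2 then 1 else x)
  else if b1 then (if x == 1 then 2 else if x == 2 then 1
                   else if x == -1 then -2 else if x == -2 then -1 else x)
  else x.

Lemma pos_prod_small e x : {subset e <= zidx n} -> uniq e -> 2 \notin e ->
  (x != 0) && (-2 <= x <= 2) -> pos (wprod e) x = act01 (0 \in e) (1 \in e) x.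
Proof.
elim: e x => [|r e IH] x hs; first by rewrite pos1.
have rI : r \in zidx n by rewrite hs // inE eqxx.
have r0 : 0 <= r < n%:Z by rewrite -mem_zidx.
have he : {subset e <= zidx n} by move=> t te; rewrite hs // inE te orbT.
rewrite cons_uniq inE negb_or => /andP [re ue] /andP [r2 e2] hx.
rewrite (pos_prod_cons (D := typeD)) // IH //=; last first.
  by rewrite ev_sD //; clear -r0 r2 hx; split_ifs.
rewrite !inE ev_sD //; case: (eqVneq r 0) => [r00|rn0].
  subst r; rewrite (negbTE re) /= /act01; clear -hx; by case: (1 \in e); split_ifs.
case: (eqVneq r 1) => [r11|rn1].
  subst r; rewrite (negbTE re) /= /act01; clear -hx; by case: (0 \in e); split_ifs.
by rewrite /act01; clear -hx r0 rn0 rn1 r2; case: (0 \in e); case: (1 \in e); split_ifs.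
Qed.

(** The word is cut at the letter 2. The letters before it act on 1 and 2 by [act01], then 2 carries
    2 to 3 and -2 to -3, and the letters after it keep what lies beyond 2 on its side. So the images
    of 1 and 2 tell where 0 and 1 stand. *)
Lemma pos_prod_12 e : perm_eq e (zidx n) -> 3 <= n%:Z ->
  let p1 := pos (wprod e) 1 in let p2 := pos (wprod e) 2 in
  [/\ before e 0 2 = (p1 <= -3) || (p2 <= -3),
      before e 1 2 = (3 <= p1) || (p2 <= -3)
    & (before e 0 2 == before e 1 2) = (p1 == -1)].
Proof.
move=> eI n3 p1 p2; have e2 : 2 \in e by rewrite (perm_mem eI) mem_zidx; lia.
have ue : uniq e by rewrite (perm_uniq eI) zidx_uniq.
have hs : {subset e <= zidx n} by move=> r; rewrite (perm_mem eI).
have I0 : 0 \in zidx n by rewrite mem_zidx; lia.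
have I1 : 1 \in zidx n by rewrite mem_zidx; lia.
have I2 : 2 \in zidx n by rewrite mem_zidx; lia.
rewrite {}/p1 {}/p2; case/splitPr: e2 eI ue hs => f g eI ue hs.
have hf : {subset f <= zidx n} by move=> r rf; rewrite hs // mem_cat rf.
have hg : {subset g <= zidx n} by move=> r rg; rewrite hs // mem_cat inE rg !orbT.
move: (ue); rewrite cat_uniq /= negb_or => /and4P [uf /andP [f2 _] g2 ug].
have bE (i : int) : i != 2 -> i \in zidx n -> before (f ++ 2 :: g) i 2 = (i \in f).
  move=> i2 iI; rewrite /before !index_cat (negbTE f2) /= ?addn0.
  case: ifP => [h|_]; first by rewrite index_mem.
  by apply/negbTE; rewrite -leqNgt leq_addr.
have gE (i : int) : i != 2 -> i \in zidx n -> (i \in g) = (i \notin f).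
  move=> i2 iI; have : i \in f ++ 2 :: g by rewrite (perm_mem eI).
  rewrite mem_cat inE (negbTE i2) /=; case: (boolP (i \in f)) => //= h _.
  apply/negP => h'; move: ue; rewrite cat_uniq => /and3P [_ /hasPn /(_ i)].
  by rewrite inE h' orbT h => /(_ isT).
rewrite !bE //.
have run (x y z : int) : x = 1 \/ x = 2 -> y = act01 (0 \in f) (1 \in f) x ->
    z = ev (sD n 2) y ->
    pos (wprod (f ++ 2 :: g)) x = pos (wprod g) z.
  move=> hx -> ->; rewrite pos_prod_cat // pos_prod_cons // (@pos_prod_small f) //.
  by case: hx => ->.
have small x := @pos_prod_small g x hg ug g2.
have large x : x \in L -> kapB 2 (pos (wprod g) x) = kapB 2 x.
  by move=> xL; exact: (kap_prod (D := typeD) I2 hg g2 xL).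
have L3 : 3 \in L by rewrite mem_pm; lia.
have L3' : -3 \in L by rewrite mem_pm; clear -n3; lia.
have l3 : 3 <= pos (wprod g) 3.
  by have := large 3 L3; rewrite /kapB; move: (pos _ _) => p; clear; split_ifs.
have l3' : pos (wprod g) (-3) <= -3.
  by have := large (-3) L3'; rewrite /kapB; move: (pos _ _) => p; clear; split_ifs.
have s1 := small 1 isT; have s1' := small (-1) isT.
move: run s1 s1'; rewrite (gE 0 isT I0) (gE 1 isT I1).
case: (0 \in f); case: (1 \in f) => run s1 s1'.
- rewrite (run 1 (-1) (-1)) ?ev_sD //; last by left.
  rewrite (run 2 (-2) (-3)) ?ev_sD //; last by right.
  by rewrite s1' l3' !orbT.
- rewrite (run 1 (-2) (-3)) ?ev_sD //; last by left.
  rewrite (run 2 (-1) (-1)) ?ev_sD //; last by right.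
  by rewrite s1' l3'; move: (pos _ _) l3' => p hp; clear -hp; split; rewrite /=; lia.
- rewrite (run 1 2 3) ?ev_sD //; last by left.
  rewrite (run 2 1 1) ?ev_sD //; last by right.
  by rewrite s1 l3; move: (pos _ _) l3 => p hp; clear -hp; split; rewrite /=; lia.
rewrite (run 1 1 1) ?ev_sD //; last by left.
rewrite (run 2 2 3) ?ev_sD //; last by right.
by rewrite s1; move: (pos _ _) l3 => p hp; clear -hp; split; rewrite /=; lia.
Qed.

End CoxeterD.

(** * Symmetric Coxeter elements *)

Section SymmetricD.

Variable n : nat.
Hypothesis hn : (2 <= n)%N.
Notation L := (pm_range n).
Notation typeD := (typeD hn).
Notation wprod := (wprod typeD).
Implicit Types (m x : int) (e b : seq int) (w : permPM n).

Definition swap01 m : int := if m == 0 then 1 else if m == 1 then 0 else m.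

Lemma swap01K : involutive swap01.
Proof. by move=> m; rewrite /swap01; split_ifs. Qed.

Lemma swap01_idx m : m \in zidx n -> swap01 m \in zidx n.
Proof using hn. by rewrite !mem_zidx /swap01; split_ifs. Qed.

Notation t := (transp L (- 1) 1).

Lemma ev_t x : ev t x = if x == - 1 then 1 else if x == 1 then - 1 else x.
Proof using hn. by rewrite ev_transp // mem_pm; lia. Qed.

Lemma t_sq : (t * t = 1)%g.
Proof using hn. by apply: ev_ext => x _; rewrite evM !ev_t ev1; split_ifs. Qed.

(** Changing the sign of 1 exchanges e_2 - e_1 and e_2 + e_1, so conjugation by [t] is the diagram
    automorphism. *)
Lemma conj_gen m : m \in zidx n -> (sD n m ^ t = sD n (swap01 m))%g.
Proof using hn.
move=> mI; apply: (mulgI t); rewrite -conjgC; apply: ev_ext => x _.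
rewrite !evM !ev_t !ev_sD ?swap01_idx //; move: mI; rewrite mem_zidx /swap01 => mI.
clear -mI; case: (eqVneq m 0) => [_|m0] /=; first by split_ifs.
by case: (eqVneq m 1) => [m1|m1] /=; split_ifs.
Qed.

Lemma conj_prod e : {subset e <= zidx n} -> (wprod e ^ t = wprod (map swap01 e))%g.
Proof.
elim: e => [|m e IH] h; first exact: conj1g.
rewrite /= !prod_cons conjMg IH ?conj_gen //; first by rewrite h // inE eqxx.
by move=> r re; rewrite h // inE re orbT.
Qed.

Lemma WD_word w : w \in WD n -> exists2 e, {subset e <= zidx n} & wprod e = w.
Proof. by case/(exists_word (D := typeD)) => e he [pe _]; exists e. Qed.

Lemma prod_WD e : {subset e <= zidx n} -> wprod e \in WD n.
Proof. exact: (grp_prod (D := typeD)). Qed.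

Lemma prod_cat e f : wprod (e ++ f) = (wprod f * wprod e)%g.
Proof. by elim: e => [|m e IH]; rewrite ?mulg1 // cat_cons !prod_cons IH mulgA. Qed.

Lemma WD_mul v w : v \in WD n -> w \in WD n -> (v * w)%g \in WD n.
Proof using hn.
move=> /WD_word [e he <-] /WD_word [f hf <-]; rewrite -prod_cat; apply: prod_WD.
by move=> m; rewrite mem_cat => /orP [/hf|/he].
Qed.

Lemma WD_conj w : w \in WD n -> (w ^ t)%g \in WD n.
Proof using hn.
move=> /WD_word [e he <-]; rewrite conj_prod //; apply: prod_WD.
by move=> m /mapP [r /he rI ->]; exact: swap01_idx.
Qed.

(** [Aut] asks for a permutation of the ambient group that is the identity outside [WD n]. *)
Definition tau w : permPM n := if w \in WD n then (w ^ t)%g else w.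

Lemma tauK : involutive tau.
Proof using hn.
move=> w; rewrite /tau; case: (boolP (w \in WD n)) => [wW|/negbTE ->] //.
by rewrite WD_conj // -conjgM t_sq conjg1.
Qed.

Lemma perm_swap01 e : perm_eq e (zidx n) -> perm_eq (map swap01 e) (zidx n).
Proof using hn.
move=> eI; apply: uniq_perm; last first.
- move=> m; apply/mapP/idP => [[r + ->]|mI]; first by rewrite (perm_mem eI); exact: swap01_idx.
  by exists (swap01 m); rewrite ?swap01K // (perm_mem eI) swap01_idx.
- exact: zidx_uniq.
by rewrite map_inj_uniq ?(perm_uniq eI) ?zidx_uniq //; exact: (inv_inj swap01K).
Qed.

(** The automorphism turns the word [e] into [map swap01 e]. If it fixes c, [pos_prod_12] for both
    words puts 0 and 1 on the same side of 2. If they are on the same side, c sends 1 to -1, hence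
    commutes with [t]. *)
Lemma symmetricDP e : perm_eq e (zidx n) -> 3 <= n%:Z ->
  symmetricD (wprod e) <-> before e 0 2 = before e 1 2.
Proof.
move=> eI n3; have he : {subset e <= zidx n} by move=> m; rewrite (perm_mem eI).
have I0 : 0 \in zidx n by rewrite mem_zidx; clear -n3; lia.
have I1 : 1 \in zidx n by rewrite mem_zidx; clear -n3; lia.
split=> [[f /[dup] fA]|bE].
  rewrite inE => /andP [_ /morphicP fM] [f0 f1 fi fc].
  have fgen m : m \in zidx n -> f (sD n m) = sD n (swap01 m).
    rewrite mem_zidx /swap01 => mI; case: (eqVneq m 0) => [-> //|m0].
    by case: (eqVneq m 1) => [-> //|m1]; apply: fi; clear -mI m0 m1; lia.
  have f11 : f 1%g = 1%g.
    by apply: (mulgI (f 1%g)); rewrite -fM ?mulg1 //; exact: (prod_WD (e := [::])).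
  have fprod g : {subset g <= zidx n} -> f (wprod g) = wprod (map swap01 g).
    elim: g => [|m g IH] hg //; have mI : m \in zidx n by rewrite hg // inE eqxx.
    have hg' : {subset g <= zidx n} by move=> r rg; rewrite hg // inE rg orbT.
    have sW : sD n m \in WD n.
      have := @prod_WD [:: m]; rewrite prod_cons mul1g; apply.
      by move=> r; rewrite inE => /eqP ->.
    by rewrite /= !prod_cons fM ?prod_WD // IH // fgen.
  have E := fprod e he; rewrite fc in E.
  have [b0 _ _] := pos_prod_12 hn eI n3.
  have [b0' _ _] := pos_prod_12 hn (perm_swap01 eI) n3.
  rewrite b0 E -b0'; rewrite /before.
  have -> : 0 = swap01 1 by []. have -> : 2 = swap01 2 by [].
  by rewrite !(index_map (inv_inj swap01K)).
have [_ _ hb] := pos_prod_12 hn eI n3.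
have p1 : pos (wprod e) 1 = - 1 by apply/eqP; rewrite -hb bE.
have cW := prod_WD he.
have sw : signed (wprod e) by move: cW; rewrite inE => /andP [].
have pN x : pos (wprod e) (- x) = - pos (wprod e) x by exact: pos_signed.
have gW m : m \in zidx n -> sD n m \in WD n.
  move=> mI; have := @prod_WD [:: m]; rewrite prod_cons mul1g; apply.
  by move=> r; rewrite inE => /eqP ->.
exists (perm (inv_inj tauK)).
  rewrite inE; apply/andP; split.
    apply/subsetP => w; rewrite inE permE /tau; case: ifP => //; by rewrite eqxx.
  apply/morphicP => v w vW wW; rewrite !permE /tau vW wW WD_mul //.
  exact: conjMg.
rewrite !permE /tau !gW // !conj_gen // cW; split=> //.
  move=> i hi; have iI : i \in zidx n by rewrite mem_zidx; clear -hi; lia.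
  by rewrite permE /tau gW // conj_gen // /swap01; clear -hi; split_ifs.
apply: (mulgI t); rewrite -conjgC; apply: ev_extV => x xL.
rewrite !invMg !evM -!/(pos _ _).
have tE y : pos t y = if y == - 1 then 1 else if y == 1 then - 1 else y.
  by rewrite -ev_t /pos (_ : t^-1 = t)%g //; apply/eqP; rewrite eq_invg_mul t_sq.
have p1' : pos (wprod e) (- 1) = 1 by rewrite pN p1 opprK.
have inj := @pos_inj _ (wprod e).
rewrite !tE; case: (eqVneq x (- 1)) => [->|xn1]; first by rewrite p1 p1'.
case: (eqVneq x 1) => [->|x1]; first by rewrite p1 p1'.
have : pos (wprod e) x != 1 by apply: contra xn1 => /eqP h; apply/eqP/inj; rewrite h p1'.
have : pos (wprod e) x != - 1 by apply: contra x1 => /eqP h; apply/eqP/inj; rewrite h p1.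
by move=> /negbTE -> /negbTE ->.
Qed.

End SymmetricD.

(** * Condition (D) as alignment *)

Section ConditionD.

Variable n : nat.
Hypothesis hn : (2 <= n)%N.
Notation L := (pm_range n).
Notation typeD := (typeD hn).
Variables (e : seq int).
Notation c := (wprod typeD e).
Hypotheses (eI : perm_eq e (zidx n)) (n3 : 3 <= n%:Z).
Hypothesis cc : coxeter_element (gens typeD) c.
Hypothesis ra : reduced_word (gens typeD) c (map (sD n) e).

Lemma precedesD (i j : int) : i \in zidx n -> j \in zidx n -> i != j ->
  (forall f, perm_eq f (zidx n) -> wprod typeD f = c -> before f i j = before e i j) ->
  (precedes (SD n) c (sD n i) (sD n j) <-> before e i j) /\
  (precedes (SD n) c (sD n j) (sD n i) <-> ~~ before e i j).
Proof.
move=> iI jI ij h; rewrite -(gensD hn).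
split; first by apply: (precedesP (D := typeD) eI ra cc iI jI ij) => f fI /(h _ fI) ->.
rewrite -before_total ?(perm_mem eI) //.
apply: (precedesP (D := typeD) eI ra cc jI iI); rewrite 1?eq_sym // => f fI E.
rewrite [before e j i]before_total ?[before f j i]before_total //.
- by rewrite h.
- by rewrite (perm_mem fI).
by rewrite (perm_mem eI).
Qed.

Lemma precedesD_large (j : int) : 3 <= j < n%:Z ->
  (precedes (SD n) c (sD n (j - 1)) (sD n j) <-> before e (j - 1) j) /\
  (precedes (SD n) c (sD n j) (sD n (j - 1)) <-> ~~ before e (j - 1) j).
Proof.
move=> hj; apply: precedesD; rewrite ?mem_zidx; try by clear -hj; lia.
by move=> f fI E; rewrite (before_invD eI fI E).
Qed.

Lemma precedesD_small (i : int) : (i == 0) || (i == 1) ->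
  (precedes (SD n) c (sD n i) (sD n 2) <-> before e i 2) /\
  (precedes (SD n) c (sD n 2) (sD n i) <-> ~~ before e i 2).
Proof.
move=> hi; apply: precedesD; rewrite ?mem_zidx; try by clear -hi n3; lia.
move=> f fI E; have [b0 b1 _] := pos_prod_12 hn eI n3.
have [b0' b1' _] := pos_prod_12 hn fI n3.
by case/orP: hi => /eqP ->; rewrite ?b0 ?b0' ?b1 ?b1' E.
Qed.

(** By [symmetricDP] the value of [barD] at 2 is nonzero for symmetric c and the value at 1
    otherwise, which matches the clauses of the definition. *)
Lemma posupperDP (i : int) : posupperD c i <-> (1 <= i < n%:Z) && (barD e i < 0).
Proof.
have [p0 q0] := @precedesD_small 0 isT; have [p1 q1] := @precedesD_small 1 isT.
have sy := symmetricDP hn eI n3.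
rewrite /posupperD; split.
  case=> [[hi /(precedesD_large hi).2 bi]|[_ -> /q0 b0 /q1 b1]|[_ -> /q0 b0 /p1 b1]].
  - by rewrite barD_ge3 /bar ?(negbTE bi); clear -hi; lia.
  - by rewrite barD2 /bar (negbTE b0) (negbTE b1); clear -n3; lia.
  by rewrite barD1 /bar (negbTE b0) b1; clear -n3; lia.
case/andP=> hi bi.
have [i1|[i2|i3]] : i = 1 \/ i = 2 \/ 3 <= i by clear -hi; lia.
- subst i; apply: Or33; move: bi; rewrite barD1 /bar.
  case b0: (before e 0 2); case b1: (before e 1 2) => // _.
  by split=> //; [move/sy; rewrite b0 b1 | apply/q0; rewrite b0 | apply/p1].
- subst i; apply: Or32; move: bi; rewrite barD2 /bar.
  case b0: (before e 0 2); case b1: (before e 1 2) => // _.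
  by split=> //; [apply/sy; rewrite b0 b1 | apply/q0; rewrite b0 | apply/q1; rewrite b1].
apply: Or31; split; first by clear -hi i3; lia.
apply/(precedesD_large _).2; first by clear -hi i3; lia.
by move: bi; rewrite barD_ge3 // /bar; case: ifP.
Qed.

Lemma poslowerDP (i : int) : poslowerD c i <-> (1 <= i < n%:Z) && (0 < barD e i).
Proof.
have [p0 q0] := @precedesD_small 0 isT; have [p1 q1] := @precedesD_small 1 isT.
have sy := symmetricDP hn eI n3.
rewrite /poslowerD; split.
  case=> [[hi bi]|[_ -> /p0 b0 /p1 b1]|[_ -> /p0 b0 /q1 b1]].
  - have {}bi : before e (i - 1) i.
      by apply: contraT => h; case: bi; apply/(precedesD_large hi).2.
    by rewrite barD_ge3 /bar ?bi; clear -hi; lia.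
  - by rewrite barD2 /bar b0 b1; clear -n3; lia.
  by rewrite barD1 /bar b0 (negbTE b1); clear -n3; lia.
case/andP=> hi bi.
have [i1|[i2|i3]] : i = 1 \/ i = 2 \/ 3 <= i by clear -hi; lia.
- subst i; apply: Or33; move: bi; rewrite barD1 /bar.
  case b0: (before e 0 2); case b1: (before e 1 2) => // _.
  by split=> //; [move/sy; rewrite b0 b1 | apply/p0 | apply/q1; rewrite b1].
- subst i; apply: Or32; move: bi; rewrite barD2 /bar.
  case b0: (before e 0 2); case b1: (before e 1 2) => // _.
  by split=> //; [apply/sy; rewrite b0 b1 | apply/p0 | apply/p1].
have hi' : 3 <= i < n%:Z by clear -hi i3; lia.
apply: Or31; split=> // /(precedesD_large hi').2 h.
by move: bi; rewrite barD_ge3 // /bar (negbTE h).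
Qed.

Lemma upperDP (i : int) : i != 0 -> - n%:Z < i < n%:Z ->
  upperD c i <-> barD e i < 0.
Proof.
move=> i0 hi; rewrite /upperD; split.
  case=> [/posupperDP /andP [] //|/poslowerDP /andP [_]|h]; last by clear -hi h; lia.
  by rewrite barDN // oppr_gt0.
move=> bi; have [ip|ip] := ltP 0 i.
  by apply: Or31; apply/posupperDP; rewrite bi andbT; clear -ip hi; lia.
by apply: Or32; apply/poslowerDP; rewrite barDN // oppr_gt0 bi andbT; clear -ip i0 hi; lia.
Qed.

Lemma lowerDP (i : int) : i != 0 -> - n%:Z < i < n%:Z ->
  lowerD c i <-> 0 < barD e i.
Proof.
move=> i0 hi; rewrite /lowerD; split.
  case=> [/poslowerDP /andP [] //|/posupperDP /andP [_]|h]; last by clear -hi h; lia.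
  by rewrite barDN // oppr_lt0.
move=> bi; have [ip|ip] := ltP 0 i.
  by apply: Or31; apply/poslowerDP; rewrite bi andbT; clear -ip hi; lia.
by apply: Or32; apply/posupperDP; rewrite barDN // oppr_lt0 bi andbT; clear -ip i0 hi; lia.
Qed.

Lemma centralDP (i : int) : i != 0 -> centralD c i <-> barD e i = 0.
Proof.
move=> i0; have sy := symmetricDP hn eI n3.
have BN : barD e i = 0 <-> barD e `|i| = 0.
  have [ip|ip] := leP 0 i; first by rewrite ger0_norm.
  rewrite ltr0_norm // barDN //; split=> [->|/eqP]; rewrite ?oppr0 //.
  by rewrite oppr_eq0 => /eqP.
rewrite BN /centralD; split.
  case=> -[/sy s ->]; rewrite ?barD1 ?barD2 /bar ?s ?subrr //.
  by case: (before e 0 2) s; case: (before e 1 2).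
move=> B0; have : `|i| = 1 \/ `|i| = 2.
  by have := @barD_neq0 e `|i|; rewrite B0; clear -i0; lia.
case=> h; [left | right]; split=> //.
  by apply/sy; move: B0; rewrite h barD1 /bar; case: (before e 0 2); case: (before e 1 2).
by move=> /sy; move: B0; rewrite h barD2 /bar; case: (before e 0 2); case: (before e 1 2).
Qed.

(** For the pattern j k i, a negative form means that [j] is upper-barred, which is (D1), or that
    [j] is central and the one of [i] and [k] smaller in absolute value is lower-barred; the barring
    of the other then selects (D2), (D3) or (D4). *)
Lemma alignedDP w : w \in WD n -> aligned typeD (formD e) w <-> condD c w.
Proof.
rewrite inE => /andP [sw _]; have sl := subseq_one_line w (pm_sorted n).
have tr i j k : i < j < k -> uniq [:: `|i|; `|j|; `|k|] ->
    subseq [:: j; k; i] (one_line w) ->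
    [/\ triple typeD i j k, pos w j < pos w k < pos w i,
        [&& i != 0, j != 0, k != 0, - n%:Z <= i & k <= n%:Z]
      & [&& i < j, j < k, i != - j, j != - k & i != - k]].
  move=> ijk; rewrite /= !inE => u /sl [[jL kL iL] h].
  have hd : [&& i < j, j < k, i != - j, j != - k & i != - k] by clear -ijk u; lia.
  have t : triple typeD i j k by apply/tripleD.
  by have [_ ? _] := tripleD_bounds t.
split=> [al|[d1 d2 d3 d4]].
  have no i j k : triple typeD i j k -> pos w j < pos w k < pos w i -> ~ (formD e i j k < 0).
    by move=> t h f; have [/(_ f)] := al _ _ _ t; rewrite h.
  split=> i j k.
  - move=> ijk u uj s; have [t h hB hd] := tr _ _ _ ijk u s; apply: (no i j k) => //.
    have b : barD e j < 0 by apply/upperDP => //; clear -hB hd; lia.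
    by rewrite /formD (ltr0_neq0 b).
  - move=> ijk u cj lk li s; have [t h hB hd] := tr _ _ _ ijk u s; apply: (no i j k) => //.
    have /centralDP b : centralD c j by [].
    rewrite /formD b ?eqxx /=; last by clear -hB; lia.
    case: (ltP (- k) i) => ki; rewrite oppr_lt0; apply/lowerDP => //; clear -ki hB hd; lia.
  - move=> ki ijk u cj uk li s; have [t h hB hd] := tr _ _ _ ijk u s; apply: (no i j k) => //.
    have /centralDP b : centralD c j by [].
    rewrite /formD b ?eqxx ?ki /=; last by clear -hB; lia.
    rewrite oppr_lt0; apply/lowerDP => //; clear -ki hB hd; lia.
  move=> ijk ki u cj lk ui s; have [t h hB hd] := tr _ _ _ ijk u s; apply: (no i j k) => //.
  have /centralDP b : centralD c j by [].
  rewrite /formD b ?eqxx /=; last by clear -hB; lia.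
  rewrite ifF; last by clear -ki; lia.
  by rewrite oppr_lt0; apply/lowerDP => //; clear -ki hB hd; lia.
have key i j k : triple typeD i j k -> formD e i j k < 0 -> ~~ (pos w j < pos w k < pos w i).
  move=> t f; apply/negP => h.
  have [_ hB hd] := tripleD_bounds t.
  have [[iL jL kL] _] := (tripleD hn _ _ _).1 t.
  have ijk : i < j < k by clear -hd; lia.
  have u : uniq [:: `|i|; `|j|; `|k|] by rewrite /= !inE; clear -hd; lia.
  have s : subseq [:: j; k; i] (one_line w) by apply/sl.
  have [i0 j0 k0] : [/\ i != 0, j != 0 & k != 0] by clear -hB; split; lia.
  (* n and -n count as both; the upper bar is chosen for them. *)
  have ul x : x != 0 -> - n%:Z <= x <= n%:Z -> barD e x != 0 -> upperD c x \/ lowerD c x.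
    move=> x0 xn bx; have [xn'|xn'] := boolP (- n%:Z < x < n%:Z); last first.
      by left; apply: Or33; clear -xn xn'; lia.
    by case: (ltgtP (barD e x) 0) bx => // b _; [left; apply/upperDP | right; apply/lowerDP].
  move: f; rewrite /formD; case: (eqVneq (barD e j) 0) => [bj|bj] /= f; last first.
    by apply: (d1 i j k) => //; apply/upperDP => //; clear -hB hd; lia.
  have cj : centralD c j by apply/centralDP.
  (* Central elements share one absolute value, so [i] and [k] are not central. *)
  have other x : x != 0 -> x != j -> x != - j -> barD e x != 0.
    move=> x0 xj xj'; apply/eqP => bx; move: (barD_small e).
    have cen z : z != 0 -> barD e z = 0 ->
        ((z == 1) || (z == - 1)) && (barD e 1 == 0) ||
        ((z == 2) || (z == - 2)) && (barD e 2 == 0).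
      move=> z0 bz; have := @barD_neq0 e z; rewrite bz eqxx => z3.
      have [?|[?|[?|?]]] : z = 1 \/ z = - 1 \/ z = 2 \/ z = - 2 by clear -z0 z3; lia.
      - by subst z; rewrite bz.
      - by move: bz; subst z; rewrite barDN // => /eqP; rewrite oppr_eq0 => ->.
      - by subst z; rewrite bz.
      by move: bz; subst z; rewrite barDN // => /eqP; rewrite oppr_eq0 => ->; rewrite !orbT.
    have := cen x x0 bx; have := cen j j0 bj; clear -xj xj'.
    by case: (barD e 1 == 0); case: (barD e 2 == 0); lia.
  move: f; case: (ltP (- k) i) => ki; rewrite oppr_lt0 => f.
    have li : lowerD c i by apply/lowerDP => //; clear -ki hB hd; lia.
    have bk : barD e k != 0 by apply: other => //; clear -hd; lia.
    have nk : - n%:Z <= k <= n%:Z by clear -hB hd; lia.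
    have [uk|lk] := ul k k0 nk bk.
      exact: (d3 i j k).
    exact: (d2 i j k).
  have lk : lowerD c k by apply/lowerDP => //; clear -ki hB hd; lia.
  have bi : barD e i != 0 by apply: other => //; clear -hd; lia.
  have ni : - n%:Z <= i <= n%:Z by clear -hB hd; lia.
  have [ui|li] := ul i i0 ni bi.
    by apply: (d4 i j k) => //; clear -ki hd; lia.
  exact: (d2 i j k).
move=> i j k t; split; first exact: key.
move=> f; have [_ hB hd] := tripleD_bounds t.
have [[iL jL kL] _] := (tripleD hn _ _ _).1 t.
(* Negating values and places reduces the pattern k i j to the pattern j k i. *)
have tN : triple typeD (- k) (- j) (- i).
  by apply/tripleD; rewrite !mem_pmN; split=> //; clear -hd; lia.
have := key _ _ _ tN; rewrite formDN; try by clear -hB hd; lia.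
by rewrite oppr_lt0 => /(_ f); rewrite !pos_signed // !ltrN2 andbC.
Qed.

End ConditionD.

Lemma sortable_condD n (c : permPM n) a w : (2 <= n)%N ->
  coxeter_element (SD n) c -> reduced_word (SD n) c a -> w \in WD n ->
  (c_sortable (SD n) a w <-> condD c w).
Proof.
move=> hn; rewrite -(gensD hn) => cc ra wW.
have [e eI [Ea Ec]] := coxeter_word (D := typeD hn) cc ra; subst a c.
apply: (iff_trans (sortable_aligned (orientD hn) eI (wW : grp (typeD hn) w))).
(* For n = 2 there are no three elements of distinct absolute values, and both sides hold
   vacuously. *)
have [n3|n3] := leP 3 n%:Z; first exact: alignedDP.
have sl := subseq_one_line w (pm_sorted n).
have vac i j k : i < j < k -> uniq [:: `|i|; `|j|; `|k|] -> ~ subseq [:: j; k; i] (one_line w).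
  by rewrite /= !inE => ijk u /sl [[]]; rewrite !mem_pm; clear -ijk u n3; lia.
split=> [_|_ i j k /tripleD_bounds [+ _ _]]; last by rewrite leNgt n3.
by split=> i j k *; exact: vac.
Qed.

Theorem theorem4p12 (n : nat) :
  [/\ (1 <= n)%N -> forall (c : permA n) (a : seq (permA n)) (w : permA n),
        coxeter_element (SA n) c -> reduced_word (SA n) c a ->
        (c_sortable (SA n) a w <-> condA c w),
      (1 <= n)%N -> forall (c : permPM n) (a : seq (permPM n)) (w : permPM n),
        coxeter_element (SB n) c -> reduced_word (SB n) c a -> w \in WB n ->
        (c_sortable (SB n) a w <-> condB c w)
    & (2 <= n)%N -> forall (c : permPM n) (a : seq (permPM n)) (w : permPM n),
        coxeter_element (SD n) c -> reduced_word (SD n) c a -> w \in WD n ->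
        (c_sortable (SD n) a w <-> condD c w)].
Proof.
split=> hn c a w; first exact: sortable_condA.
  exact: sortable_condB.
exact: sortable_condD.
Qed.
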